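(* For $n\geq 2$, the number $t_n(213)$ of permutations $\pi\in\mathcal{S}_n$ such that both $\pi$ and $\theta(\pi)$ avoid $213$ equals $2F_{n+2}+n^2-6n+4$, where $F_m$ is the $m$-th Fibonacci number. Equivalently, for $n\ge 2$, $t_n(213)$ is the coefficient of $x^n$ in the rational function $$\frac{2x^5+9x^4-8x^3-10x^2+13x-4}{(x-1)^3(1-x-x^2)}.$$
   Context: $\mathcal{S}_n$ is the symmetric group on $[n]$, permutations in one-line notation $\pi_1\cdots\pi_n$. A permutation avoids a pattern $\tau$ if it has no subsequence order-isomorphic to $\tau$. The standard cycle notation of $\pi$ writes each cycle (fixed points included) with its largest element first and orders cycles by increasing largest element. The fundamental bijection $\theta:\mathcal{S}_n\to\mathcal{S}_n$ maps $\pi$ to the permutation whose one-line notation is obtained by erasing the parentheses of the standard cycle notation of $\pi$. Fibonacci numbers: $F_0=0$, $F_1=F_2=1$, $F_{m}=F_{m-1}+F_{m-2}$. *)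

(* Defs.v *)
From HB Require Import structures.
From mathcomp Require Import all_boot all_order all_fingroup all_algebra.

Set Implicit Arguments.
Unset Strict Implicit.
Unset Printing Implicit Defensive.

Import GRing.Theory.

(* 'S_n acts on {0, ..., n-1}; one-line words are shifted to [n] = {1, ..., n}. *)
Definition oneline (n : nat) (p : 'S_n) : seq nat :=
  [seq (p i).+1 | i <- enum 'I_n].

Definition order_iso (s t : seq nat) : bool :=
  (size s == size t) &&
  [forall i : 'I_(size s), forall j : 'I_(size s),
     (nth 0 s i < nth 0 s j) == (nth 0 t i < nth 0 t j)].

(* The subsequences of w are the words mask m w, for m a bit mask on w. *)
Definition avoids (w tau : seq nat) : bool :=
  ~~ [exists m : (size w).-tuple bool, order_iso (mask m w) tau].

Definition cycle_maxima (n : nat) (p : 'S_n) : seq 'I_n :=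
  [seq i <- enum 'I_n | [forall j in porbit p i, j <= i]].

(* The cycle through i, written i, p i, p (p i), ... *)
Definition cycle_from (n : nat) (p : 'S_n) (i : 'I_n) : seq 'I_n :=
  traject p i #|porbit p i|.

(* cycle_maxima is increasing because enum 'I_n is. *)
Definition standard_cycles (n : nat) (p : 'S_n) : seq (seq 'I_n) :=
  [seq cycle_from p i | i <- cycle_maxima p].

Definition theta_word (n : nat) (p : 'S_n) : seq 'I_n :=
  flatten (standard_cycles p).

Lemma mem_cycle_from (n : nat) (p : 'S_n) (i j : 'I_n) :
  (j \in cycle_from p i) = (j \in porbit p i).
Proof. by rewrite /cycle_from porbit_traject. Qed.

Lemma theta_word_uniq (n : nat) (p : 'S_n) : uniq (theta_word p).
Proof.
have -> : theta_word p = [seq j | i <- cycle_maxima p, j <- cycle_from p i].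
  by congr flatten; apply: eq_map => i; rewrite map_id.
apply: allpairs_uniq_dep.
- exact/filter_uniq/enum_uniq.
- by move=> i _; apply: uniq_traject_porbit.
move=> u v /allpairsPdep[i [j [mi mj ->]]] /allpairsPdep[k [l [mk ml ->]]] /= ejl.
move: mj ml; rewrite -{}ejl !mem_cycle_from => ij kj.
suff eik: i = k by rewrite eik.
have eP: porbit p i = porbit p k.
  by rewrite -(eqP (_ : porbit p j == porbit p i)) ?eq_porbit_mem //;
     apply/eqP; rewrite eq_porbit_mem.
move: mi mk; rewrite !mem_filter => /andP[/forallP mi _] /andP[/forallP mk _].
apply/val_inj/eqP; rewrite eqn_leq.
by rewrite (implyP (mk i)) -?eP ?porbit_id // (implyP (mi k)) // eP porbit_id.
Qed.

Lemma mem_theta_word (n : nat) (p : 'S_n) (j : 'I_n) : j \in theta_word p.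
Proof.
have jj: j \in porbit p j by exact: porbit_id.
case: (@arg_maxnP _ j (mem (porbit p j)) val jj) => i ij imax.
have eP: porbit p i = porbit p j by apply/eqP; rewrite eq_porbit_mem.
apply/flattenP; exists (cycle_from p i); last by rewrite mem_cycle_from eP.
apply: map_f; rewrite mem_filter mem_enum andbT; apply/forallP => k.
by apply/implyP; rewrite eP => /imax.
Qed.

Lemma size_theta_word (n : nat) (p : 'S_n) : size (theta_word p) = n.
Proof.
rewrite -(card_uniqP (theta_word_uniq p)) -[RHS]card_ord.
by apply: eq_card => j; rewrite !inE mem_theta_word.
Qed.

Lemma theta_inj (n : nat) (p : 'S_n) :
  injective (fun i : 'I_n => nth i (theta_word p) i).
Proof.
move=> i j /= e; apply: val_inj; apply/eqP.
rewrite -(nth_uniq i _ _ (theta_word_uniq p)) ?size_theta_word ?ltn_ord //.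
by rewrite e (set_nth_default i) // size_theta_word.
Qed.

Definition theta (n : nat) (p : 'S_n) : 'S_n := perm (@theta_inj n p).

Lemma oneline_theta (n : nat) (p : 'S_n) :
  oneline (theta p) = [seq (nat_of_ord i).+1 | i <- theta_word p].
Proof.
rewrite /oneline; case: n p => [|n] p.
  have /size0nil -> : size (theta_word p) = 0 by rewrite size_theta_word.
  by apply/size0nil; rewrite size_map size_enum_ord.
apply: (@eq_from_nth _ 0); first by rewrite size_map size_enum_ord size_map size_theta_word.
rewrite size_map size_enum_ord => i lti.
rewrite (nth_map ord0) ?size_theta_word //.
rewrite (@nth_map 'I_n.+1 ord0 _ _ (fun k => (theta p k).+1)) ?size_enum_ord //.
rewrite permE nth_enum_ord //.
by congr (nat_of_ord _).+1; apply: set_nth_default; rewrite size_theta_word.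
Qed.

(* t_n(tau) *)
Definition tcount (n : nat) (tau : seq nat) : nat :=
  #|[set p : 'S_n | avoids (oneline p) tau && avoids (oneline (theta p)) tau]|.

Fixpoint fib (m : nat) : nat :=
  match m with
  | 0 => 0
  | 1 => 1
  | (k.+1 as k1).+1 => fib k1 + fib k
  end.

Local Open Scope ring_scope.

(* First m coefficients of the power series P / Q, by long division;
   meaningful when Q`_0 != 0, see quot_coefP and quot_coef_unique. *)
Fixpoint quot_prefix (F : fieldType) (P Q : {poly F}) (m : nat) : seq F :=
  if m is k.+1 then
    let s := quot_prefix P Q k in
    rcons s ((P`_k - \sum_(i < k) Q`_i.+1 * s`_(k - i.+1)) / Q`_0)
  else [::].

(* The coefficient of x^m in the power series expansion of P / Q at 0. *)
Definition quot_coef (F : fieldType) (P Q : {poly F}) (m : nat) : F :=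
  (quot_prefix P Q m.+1)`_m.

Lemma size_quot_prefix (F : fieldType) (P Q : {poly F}) (m : nat) :
  size (quot_prefix P Q m) = m.
Proof. by elim: m => //= m IH; rewrite size_rcons IH. Qed.

Lemma nth_quot_prefix (F : fieldType) (P Q : {poly F}) (m k : nat) :
  (k < m)%N -> (quot_prefix P Q m)`_k = quot_coef P Q k.
Proof.
elim: m => // m IH; rewrite ltnS leq_eqVlt => /predU1P[-> //|km].
by rewrite /= nth_rcons size_quot_prefix km IH.
Qed.

Lemma quot_coefE (F : fieldType) (P Q : {poly F}) (m : nat) :
  quot_coef P Q m =
  (P`_m - \sum_(i < m) Q`_i.+1 * quot_coef P Q (m - i.+1)) / Q`_0.
Proof.
rewrite {1}/quot_coef /= nth_rcons size_quot_prefix ltnn eqxx.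
congr ((_ - _) / _); apply: eq_bigr => i _; rewrite nth_quot_prefix //.
by rewrite ltn_subrL /= (leq_ltn_trans _ (ltn_ord i)).
Qed.

Lemma quot_coefP (F : fieldType) (P Q : {poly F}) (m : nat) :
  Q`_0 != 0 -> \sum_(i < m.+1) Q`_i * quot_coef P Q (m - i) = P`_m.
Proof.
move=> Q0; rewrite big_ord_recl subn0 quot_coefE mulrCA divff // mulr1.
by rewrite subrK.
Qed.

Lemma quot_coef_unique (F : fieldType) (P Q : {poly F}) (c : nat -> F) :
  Q`_0 != 0 -> (forall m, \sum_(i < m.+1) Q`_i * c (m - i)%N = P`_m) ->
  forall m, c m = quot_coef P Q m.
Proof.
move=> Q0 cP m; elim/ltn_ind: m => m IH.
apply: (mulfI Q0); rewrite quot_coefE mulrCA divff // mulr1 -cP.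
rewrite big_ord_recl subn0.
rewrite [X in _ + X - _](_ : _ = \sum_(i < m) Q`_i.+1 * quot_coef P Q (m - i.+1)).
  by rewrite addrK.
apply: eq_bigr => i _; rewrite IH //.
by rewrite /= ltn_subrL (leq_ltn_trans _ (ltn_ord i)).
Qed.

Definition gf_num : {poly rat} :=
  2%:R * 'X^5 + 9%:R * 'X^4 - 8%:R * 'X^3 - 10%:R * 'X^2 + 13%:R * 'X - 4%:R.

Definition gf_den : {poly rat} := ('X - 1) ^+ 3 * (1 - 'X - 'X^2).

Lemma gf_den0 : gf_den`_0 != 0.
Proof. by rewrite -horner_coef0 /gf_den !hornerE. Qed.

(* Main.v *)
Require Import Defs.
From mathcomp Require Import all_boot all_order all_fingroup all_algebra.
From mathcomp Require Import zify ring.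

(** If [theta p] avoids 213, then the cycle containing the largest letter N is
    the only nontrivial cycle of [p]: any other one starts with a descent in
    [theta p] and is followed by N. So [p] is given by the word [N :: s] of that
    cycle.

    When the smallest letter 0 is not fixed, avoidance by [p] and by [s] forces
    [s] to end or to begin with 0. If it ends with 0, then [s] is 0 alone, or it
    ends with 1 0 and deleting 0 shortens the word, or it has the form 1 z 0. If it
    begins with 0, then [s] is 0 alone, or it begins with 0 1 and deleting 0
    shortens the word, or it has the form 0 z 1, in bijection with 1 z 0. Finally
    1 z 0 is either increasing up to its last letter, or begins with 1 (N-1), and
    then deleting 1 and N-1 gives a shorter word that ends with 0 and misses no
    letter. The number r(N) of such words satisfies r(N) = r(N-1) + r(N-2) + 1,
    which is the source of the Fibonacci numbers. *)

Set Implicit Arguments.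
Unset Strict Implicit.
Unset Printing Implicit Defensive.

(** * Words avoiding 213 *)

Lemma pairwise_subseq (T : eqType) (r : rel T) s :
  (forall a b, subseq [:: a; b] s -> r a b) -> pairwise r s.
Proof.
elim: s => //= x s IHs rs; apply/andP; split.
  by apply/allP => y ys; apply: rs; rewrite eqxx sub1seq.
by apply: IHs => a b sub; apply: rs; case: eqP => _ //; apply: cons_subseq sub.
Qed.

Definition not213 (a b c : nat) : bool := ~~ ((b < a) && (a < c)).

(** Recursion on the first letter, which can only be the 2 of a pattern; this suits words that
    change at their ends. *)
Fixpoint av213 (s : seq nat) : bool :=
  if s is a :: s' then pairwise (not213 a) s' && av213 s' else true.

Lemma av213_cons a s : av213 (a :: s) = pairwise (not213 a) s && av213 s.
Proof. by []. Qed.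

Arguments av213 : simpl never.

Lemma av213P s :
  reflect (forall a b c, subseq [:: a; b; c] s -> not213 a b c) (av213 s).
Proof.
apply: (iffP idP) => [|av].
  elim: s => [|x s IHs] //; rewrite av213_cons => /andP[px avs] a b c /=.
  case: eqP => [-> sub|_ sub]; last exact: IHs.
  by have := subseq_pairwise sub px; rewrite pairwise2.
elim: s av => [|x s IHs] av //; apply/andP; split.
  by apply: pairwise_subseq => b c sub; apply: av; rewrite /= eqxx.
by apply: IHs => a b c sub; apply: av; apply: subseq_trans (subseq_cons _ _).
Qed.

Lemma pairwise_not213_map (f : nat -> nat) x s :
    {in x :: s &, {mono f : u v / u < v}} ->
  pairwise (not213 (f x)) (map f s) = pairwise (not213 x) s.
Proof.
move=> fM; rewrite pairwise_map; apply: (@eq_in_pairwise _ (mem s)).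
  move=> u v us vs; rewrite /not213 /= !fM ?inE ?eqxx //.
  - exact/orP/or_intror.
  - exact/orP/or_intror.
exact/allP.
Qed.

Lemma av213_map (f : nat -> nat) s :
  {in s &, {mono f : u v / u < v}} -> av213 (map f s) = av213 s.
Proof.
elim: s => //= x s IHs fM; rewrite !av213_cons pairwise_not213_map // IHs //.
by move=> u v us vs; rewrite fM // inE ?us ?vs orbT.
Qed.

Lemma av213_cons_max a s : all (geq a) s -> av213 (a :: s) = av213 s.
Proof.
rewrite av213_cons => sa; rewrite andbC; case: av213 => //=; move: sa.
apply: contraTT => /(pairwiseP 0) nP; apply/negP => /allP sa; apply: nP.
move=> i j lti ltj _; rewrite /not213 negb_and -!leqNgt.
by apply/orP; right; have := sa _ (mem_nth 0 ltj).
Qed.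

Lemma pairwise_not213_0 s : pairwise (not213 0) s.
Proof. by elim: s => //= x s ->; rewrite andbT; apply/allP => y. Qed.

Lemma pairwise_not213_ge x s : all (leq x) s -> pairwise (not213 x) s.
Proof.
move=> /allP sx; apply/(pairwiseP 0) => i j lti ltj _.
by rewrite /not213 ltnNge sx // mem_nth.
Qed.

Lemma av213_0_cons s : av213 (0 :: s) = av213 s.
Proof. by rewrite av213_cons pairwise_not213_0. Qed.

Lemma pairwise_not213_rcons x y s :
  y <= x -> pairwise (not213 x) (rcons s y) = pairwise (not213 x) s.
Proof.
move=> yx; rewrite pairwise_rcons andb_idl // => _.
by apply/allP => u _; rewrite /not213; lia.
Qed.

(** A last letter can only play the 3, which needs two distinct values below it. *)
Lemma av213_rcons_le1 s y : y <= 1 -> av213 (rcons s y) = av213 s.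
Proof.
move=> y1; elim: s => [|x s IHs]; rewrite //= !av213_cons IHs; congr (_ && _).
case: (leqP y x) => yx; first exact: pairwise_not213_rcons.
have -> : x = 0 by lia.
by rewrite !pairwise_not213_0.
Qed.

(** * Successors in a cyclic word *)

Local Arguments next : simpl never.

Lemma next_at_notin (T : eqType) (x y0 y y' : T) p :
  x != y -> x != y' -> next_at x y0 y p = next_at x y0 y' p.
Proof. by case: p => [|z p] /= /negPf -> /negPf ->. Qed.

Lemma next_at_last (T : eqType) (y0 y : T) p :
  uniq (y :: p) -> next_at (last y p) y0 y p = y0.
Proof.
elim: p y => [|z p IHp] y /=; first by rewrite eqxx.
case/andP=> yp up; rewrite IHp //; case: eqP => // e.
by rewrite -e mem_last in yp.
Qed.

(** [y0] matters only as the successor of the last letter, where the cycle closes. *)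
Lemma next_at_nlast (T : eqType) (x y0 y1 y : T) p :
  x != last y p -> next_at x y0 y p = next_at x y1 y p.
Proof.
elim: p y => [|z p IHp] y /=; first by move/negPf->.
by move=> xl; rewrite IHp.
Qed.

Lemma next_notin (T : eqType) (x : T) p : x \notin p -> next p x = x.
Proof. by rewrite next_nth => /negPf ->. Qed.

Lemma next_inj (T : eqType) (p : seq T) : uniq p -> injective (next p).
Proof. by move=> up; apply: can_inj (prev_next up). Qed.

Lemma next_mid (T : eqType) (p q : seq T) x y :
  uniq (p ++ x :: y :: q) -> next (p ++ x :: y :: q) x = y.
Proof.
move=> u; rewrite -(next_rot (size p) u) rot_size_cat /next /=.
by rewrite eqxx.
Qed.

Lemma next_lastE (T : eqType) (x : T) p :
  uniq (x :: p) -> next (x :: p) (last x p) = x.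
Proof. exact: next_at_last. Qed.

(** * Cycle words *)

(* [N :: s] is the word of the only nontrivial cycle of a
   permutation of {0, ..., N}, written from its largest element N; [next (N :: s)]
   is then the permutation, since [next] fixes the letters outside the word. *)
Definition line N s := [seq next (N :: s) i | i <- iota 0 N.+1].

(* The fixed points precede the nontrivial cycle in the image under theta. *)
Definition fixed_ok N s :=
  all (fun x => (x \in s) || pairwise (not213 x) s) (iota 0 N).

(** [good_valid] and [valid_good] show that these words describe the nonidentity permutations p such
    that p and theta p avoid 213. The identity, with [s] empty, is counted apart. *)
Definition valid N s :=
  [&& s != [::], uniq s, all (gtn N) s, av213 (line N s), av213 s
    & fixed_ok N s].

Lemma lt_uniq N s : all (gtn N) s -> uniq s -> uniq (N :: s).
Proof.
move=> /allP sN us; rewrite cons_uniq us andbT.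
by apply/negP => /sN /=; rewrite ltnn.
Qed.

Lemma next_le N s x : all (gtn N) s -> x <= N -> next (N :: s) x <= N.
Proof.
move=> /allP sN xN; case: (boolP (x \in N :: s)) => [|/next_notin -> //].
by rewrite -mem_next inE => /predU1P[-> //|/sN/ltnW].
Qed.

(** * Raising all letters and adding a letter 0 *)

Lemma allgtnS N s : all (gtn N.+1) (map S s) = all (gtn N) s.
Proof. by rewrite all_map; apply: eq_all => x. Qed.

Lemma uniq_mapS s : uniq (map S s) = uniq s.
Proof. by rewrite map_inj_uniq //; apply: succn_inj. Qed.

Lemma mem0_mapS s : 0 \in map S s = false.
Proof. by apply/negP => /mapP[]. Qed.

Lemma mem_mapS x s : x.+1 \in map S s = (x \in s).
Proof. by rewrite mem_map //; apply: succn_inj. Qed.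

Lemma av213_mapS s : av213 (map S s) = av213 s.
Proof. by apply: av213_map => u v _ _; rewrite ltnS. Qed.

Lemma next_mapS N s x :
  uniq (N :: s) -> next (N.+1 :: map S s) x.+1 = (next (N :: s) x).+1.
Proof. by move=> u; rewrite -(next_map succn_inj u). Qed.

Lemma iota_rcons m n : iota m n.+1 = rcons (iota m n) (m + n).
Proof. by rewrite -addn1 iotaD cats1. Qed.

Lemma lineS N s :
  line N s = next (N :: s) 0 :: [seq next (N :: s) i.+1 | i <- iota 0 N].
Proof. by rewrite /line /= (iotaDl 1 0) -map_comp. Qed.

Lemma line_rcons N s :
  line N s = rcons [seq next (N :: s) i | i <- iota 0 N] (next (N :: s) N).
Proof. by rewrite /line iota_rcons map_rcons. Qed.

Lemma fixed_okS N s : fixed_ok N.+1 s =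
  all (fun x => (x.+1 \in s) || pairwise (not213 x.+1) s) (iota 0 N).
Proof.
by rewrite /fixed_ok /= pairwise_not213_0 orbT /= (iotaDl 1 0) all_map.
Qed.

Lemma pairwise_not213_mapS x s :
  pairwise (not213 x.+1) (map S s) = pairwise (not213 x) s.
Proof. by apply: pairwise_not213_map => u v _ _; rewrite ltnS. Qed.

(** Raising the letters makes 0 a fixed point. It comes first in the permutation and in its image
    under theta, and a leading 0 cannot be the 2 of a pattern. *)
Lemma valid_shift N s : valid N.+1 (map S s) = valid N s.
Proof.
rewrite /valid -!size_eq0 size_map uniq_mapS allgtnS av213_mapS.
apply: andb_id2l => _; apply: andb_id2l => us; apply: andb_id2l => sN.
have u := lt_uniq sN us.
congr [&& _, _ & _].
- rewrite lineS next_notin ?inE ?mem0_mapS // av213_0_cons -[RHS]av213_mapS.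
  rewrite /line -map_comp; congr av213.
  by apply: eq_map => i; rewrite next_mapS.
- by rewrite fixed_okS; apply: eq_all => x; rewrite mem_mapS pairwise_not213_mapS.
Qed.

(** As [map S s] ends with 1, the new cycle closes with 1, 0, N + 1. The default 1 in [last]
    excludes the empty word. *)
Lemma next_rcons0 N s x : uniq (N :: s) -> last 1 s = 0 ->
  next (N.+1 :: rcons (map S s) 0) x =
    if x == 0 then N.+1 else if x == 1 then 0 else (next (N :: s) x.-1).+1.
Proof.
move=> u l0.
have u' : uniq (0 :: N.+1 :: map S s).
  by rewrite cons_uniq -map_cons mem0_mapS uniq_mapS.
(* Rotating 0 to the front does not change the successors. *)
rewrite -rcons_cons -rot1_cons next_rot //.
case: x => [|[|x]] //.
- rewrite /next /= -[1]/(0.+1) -[in LHS]l0.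
  have -> : (last 1 s).+1 = last N.+1 (map S s).
    by case: s u l0 {u'} => //= y s _ _; rewrite last_map.
  by rewrite next_at_last //; case/andP: u'.
- rewrite {1}/next [LHS]/= (@next_at_nlast _ _ _ N.+1); first exact: next_mapS.
  by case: s u l0 {u'} => //= y s _ l0; rewrite last_map l0.
Qed.

(** The one-line word N, w becomes N + 1, 0, then w raised by one. A leading maximum is in no
    pattern, nor is a 0 right after it. *)
Lemma valid_rcons0 N s :
  last 1 s = 0 -> valid N.+1 (rcons (map S s) 0) = valid N s.
Proof.
move=> l0; rewrite /valid -!size_eq0 size_rcons rcons_uniq mem0_mapS uniq_mapS /=.
rewrite all_rcons allgtnS /=.
have -> : size s != 0 by case: (s) l0.
apply: andb_id2l => us; apply: andb_id2l => sN.
have u := lt_uniq sN us.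
rewrite av213_rcons_le1 // av213_mapS; congr [&& _, _ & _].
- have nx := next_rcons0 _ u l0.
  have n0 : next (N :: s) 0 = N.
    by have := next_lastE u; rewrite (_ : last N s = 0) //; case: s l0 {us sN u nx}.
  rewrite !lineS nx n0 (@av213_cons_max N.+1); last first.
    apply/allP => _ /mapP[i + ->]; rewrite mem_iota nx => iN /=.
    by case: eqP => // _; rewrite ltnS next_le.
  rewrite (@av213_cons_max N); last first.
    apply/allP => _ /mapP[i + ->]; rewrite mem_iota => iN.
    by rewrite /= next_le.
  rewrite /= nx /= av213_0_cons -[RHS]av213_mapS (iotaDl 1 0) -!map_comp.
  by congr av213; apply: eq_map => i /=; rewrite nx.
- rewrite fixed_okS; apply: eq_all => x.
  by rewrite mem_rcons inE /= mem_mapS pairwise_not213_rcons // pairwise_not213_mapS.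
Qed.

(** The one-line word w, 0 becomes 1, w raised by one, 0. The leading 1 exceeds only the final 0,
    which cannot be a 3. *)
Lemma valid_cons0 N s :
  head 1 s = 0 -> valid N.+1 (0 :: map S s) = valid N s.
Proof.
move=> h0; rewrite /valid /= mem0_mapS uniq_mapS allgtnS.
have -> : s != [::] by case: (s) h0.
apply: andb_id2l => us; apply: andb_id2l => sN.
have u := lt_uniq sN us.
rewrite av213_0_cons av213_mapS; congr [&& _, _ & _].
- have nx x : next (N.+1 :: 0 :: map S s) x =
    if x == 0 then 1 else if x == N.+1 then 0 else (next (N :: s) x.-1).+1.
    case: s h0 us sN u => //= y s -> us sN u.
    have [->|xN] := eqVneq x N.+1; first by rewrite /next /= eqxx.
    case: x xN => [|x] // xN.
    by rewrite /= -(next_mapS _ u) /next /= (negPf xN).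
  have nN : next (N :: s) N = 0.
    by case: s h0 us sN u nx => //= y s -> _ _ _ _; rewrite /next /= eqxx.
  rewrite lineS nx line_rcons nN av213_rcons_le1 // av213_cons.
  have -> : [seq next (N.+1 :: 0 :: map S s) i.+1 | i <- iota 0 N.+1] =
      rcons (map S [seq next (N :: s) i | i <- iota 0 N]) 0.
    rewrite iota_rcons map_rcons nx /= eqxx -map_comp; congr rcons.
    apply/eq_in_map => i; rewrite mem_iota nx /= => iN.
    by case: eqP => // ?; lia.
  rewrite av213_rcons_le1 // pairwise_not213_rcons // av213_mapS andb_idl // => _.
  by rewrite pairwise_not213_mapS pairwise_not213_0.
- rewrite fixed_okS; apply: eq_all => x; rewrite inE /= mem_mapS.
  rewrite pairwise_not213_mapS; case: (boolP (x \in s)) => //= xs.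
  (* [s] already starts with a 0 below x, so a pattern using the new letter 0 yields one in [s]. *)
  rewrite andb_idl // => px; rewrite all_map.
  case: s h0 xs px {us sN u} => //= y s ->; rewrite inE negb_or => /andP[x0 xs].
  case/andP=> /allP px _; rewrite /not213 /=.
  by apply/allP => z /px; rewrite /not213 /=; lia.
Qed.

(** * Exchanging the letters 0 and 1 *)

Definition swap01 x := if x == 0 then 1 else if x == 1 then 0 else x.

Lemma swap01K : involutive swap01.
Proof. by case=> [|[]]. Qed.

Lemma iota3E N : iota 0 N.+3 = 0 :: 1 :: rcons (iota 2 N) N.+2.
Proof. by rewrite iota_rcons. Qed.

(** The permutations are conjugate by the transposition of 0 and 1. With y the first letter of [z],
    their one-line words are y, N, m', 0 and N, y, m, 1, where m' is m with 0 replaced by 1. As m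
    lacks 1, the order is kept, and moving N past y affects no pattern. *)
Lemma valid_swap01 N z : z != [::] ->
  valid N (0 :: rcons z 1) = valid N (1 :: rcons z 0).
Proof.
move=> z0; rewrite /valid; congr andb.
have uE : uniq (0 :: rcons z 1) = uniq (1 :: rcons z 0).
  by rewrite /= !mem_rcons !rcons_uniq !inE /=; do ![case: (_ \in _) => //=].
rewrite {}uE; apply: andb_id2l => us.
case: N => [|[|N]]; try by rewrite /= ?all_rcons /= ?andbF.
rewrite [all _ (0 :: _)]/= [all _ (1 :: _)]/= !all_rcons.
apply: andb_id2l => zN.
have sN : all (gtn N.+2) (1 :: rcons z 0) by rewrite /= all_rcons.
have u := lt_uniq sN us.
have z2 : all (leq 2) z.
  move: us; rewrite /= mem_rcons inE rcons_uniq => /and3P[h1 h0 _].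
  apply/allP => -[|[|x]] // xz; first by rewrite xz in h0.
  by rewrite xz in h1.
have zE : map swap01 z = z.
  by rewrite -[RHS]map_id; apply/eq_in_map => x /(allP z2); case: x => [|[]].
congr [&& _, _ & _].
- pose f := next (N.+2 :: 1 :: rcons z 0).
  have -> : line N.+2 (0 :: rcons z 1) = [seq swap01 (f (swap01 i)) | i <- iota 0 N.+3].
    apply: eq_map => i; rewrite -(next_map (can_inj swap01K) u) swap01K /=.
    by rewrite map_rcons zE.
  have f_inj : injective f by apply: next_inj.
  have fN : f N.+2 = 1 by rewrite /f /next /= eqxx.
  have f0 : f 0 = N.+2.
    by have := next_lastE u; rewrite /= last_rcons.
  have [y [yf y2 yN]] : exists y, [/\ f 1 = y, 1 < y & y < N.+2].
    case: z z0 z2 zN @f {us sN u zE f_inj fN f0} => //= y z _ /andP[y2 _].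
    by case/andP=> yN _; exists y; split=> //; rewrite /next.
  pose m := [seq f i | i <- iota 2 N].
  have mE : [seq swap01 (f (swap01 i)) | i <- iota 2 N] = map swap01 m.
    by rewrite -map_comp; apply/eq_in_map => -[|[|i]] //=; rewrite mem_iota.
  have m1 x : x \in m -> x != 1.
    case/mapP => i + ->; rewrite mem_iota -fN (inj_eq f_inj); lia.
  have mN : all (geq N.+2) m.
    apply/allP => _ /mapP[i + ->]; rewrite mem_iota => ?.
    by rewrite /= next_le //; lia.
  have swapN x : 1 < x -> swap01 x = x by case: x => [|[]].
  rewrite /line -/f iota3E !map_cons !map_rcons mE -/m.
  rewrite -[swap01 0]/1 -[swap01 1]/0 (swapN N.+2) // fN f0 yf.
  rewrite -!rcons_cons !av213_rcons_le1 //.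
  rewrite (@av213_cons_max N.+2) /=; last by rewrite mN ltnW.
  rewrite !swapN // av213_cons (@av213_cons_max N.+2); last first.
    rewrite all_map; apply/allP => x /(allP mN); rewrite /swap01 /=.
    by case: x => [|[|]].
  rewrite /= [all _ _](_ : _ = true) /=; last by apply/allP => x _; rewrite /not213; lia.
  rewrite -av213_cons -{1}(swapN y) // -map_cons av213_map // => a b.
  rewrite !inE => am bm.
  have: a != 1 by case/predU1P: am => [->|/m1] //; lia.
  have: b != 1 by case/predU1P: bm => [->|/m1] //; lia.
  by rewrite /swap01; case: a {am} => [|[|a]]; case: b {bm} => [|[|b]].
- rewrite av213_0_cons av213_rcons_le1 //= av213_cons av213_rcons_le1 //.
  by rewrite pairwise_not213_rcons // pairwise_not213_ge //; apply: sub_all z2 => y /ltnW.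
- apply: eq_in_all => x _; rewrite !inE !mem_rcons !inE orbCA.
  case: x => [|[|x]]; rewrite //= ?orbT //.
  by rewrite !pairwise_not213_rcons // !all_rcons /not213 /=.
Qed.

(** * Words that miss no letter *)

Lemma full_mem N s x :
  uniq s -> all (gtn N) s -> size s = N -> x < N -> x \in s.
Proof.
move=> us /allP sN szs xN.
have sub : {subset s <= iota 0 N} by move=> y /sN; rewrite mem_iota.
by have [|_ ->] := uniq_min_size us sub; rewrite ?mem_iota ?size_iota ?szs.
Qed.

Lemma fixed_ok_full N s :
  uniq s -> all (gtn N) s -> size s = N -> fixed_ok N s.
Proof.
move=> us sN szs; apply/allP => x; rewrite mem_iota => xN.
by rewrite (full_mem us sN szs).
Qed.

(** Frees the value 1, keeping 0 and the order of the letters. *)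
Definition skip1 v := v + (0 < v).

Lemma skip1_mono : {mono skip1 : u v / u < v}.
Proof. by move=> u v; rewrite /skip1; lia. Qed.

Lemma skip1_inj : injective skip1.
Proof. by move=> u v; rewrite /skip1; lia. Qed.

(** The one-line word N, w becomes N + 2, N + 1, [map skip1 w], 1: the two leading maxima and the
    final 1 are in no pattern. In the cycle word, the leading 1 exceeds only the final 0. *)
Lemma valid_insert N s :
    1 < N -> all (gtn N) s -> size s = N -> last 1 s = 0 ->
  valid N.+2 (1 :: N.+1 :: map skip1 s) = valid N s.
Proof.
move=> N1 sN szs l0; rewrite /valid.
have -> : s != [::] by case: (s) l0.
have n1 : 1 \notin map skip1 s by apply/mapP => -[x _]; rewrite /skip1; lia.
have nN : N.+1 \notin map skip1 s.
  by apply/mapP => -[x /(allP sN) /=]; rewrite /skip1; lia.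
have hN : all (gtn N.+1) (map skip1 s).
  by rewrite all_map; apply: sub_all sN => x /=; rewrite /skip1; lia.
have uE : uniq [:: 1, N.+1 & map skip1 s] = uniq s.
  by rewrite !cons_uniq inE (negPf n1) nN (map_inj_uniq skip1_inj) orbF; lia.
have sN' : all (gtn N.+2) [:: 1, N.+1 & map skip1 s].
  by rewrite /= ltnSn /=; apply: sub_all hN => x /=; lia.
rewrite uE sN sN' /=; apply: andb_id2l => us.
have u := lt_uniq sN us.
have us' : uniq [:: 1, N.+1 & map skip1 s] by rewrite uE.
have u' := lt_uniq sN' us'.
rewrite !fixed_ok_full //; last by rewrite /= size_map szs.
rewrite av213_cons (_ : pairwise _ _ = true); last first.
  case/lastP: s l0 us {sN szs n1 nN hN sN' us' u u' uE} => // s x.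
  rewrite last_rcons rcons_uniq => -> /andP[s0 _].
  rewrite map_rcons -rcons_cons pairwise_not213_rcons //.
  rewrite pairwise_not213_ge //= all_map; apply/allP => -[|y] //.
  by move=> y0; rewrite y0 in s0.
rewrite av213_cons_max; last by apply: sub_all hN => x /ltnW.
rewrite (av213_map (in2W skip1_mono)); congr andb.
rewrite (lineS N s) /line iota3E !map_cons map_rcons.
set g := next (N :: s); set f := next _.
have g0 : g 0 = N by have := next_lastE u; rewrite (_ : last N s = 0) //; case: (s) l0.
have f0 : f 0 = N.+2.
  have := next_lastE u'; rewrite /= (_ : last N.+1 _ = 0) //.
  by case: (s) l0 => //= y t; rewrite last_map => ->.
have f1 : f 1 = N.+1 by rewrite /f /next.
have fN : f N.+2 = 1 by rewrite /f /next /= eqxx.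
rewrite f0 f1 fN g0 -!rcons_cons av213_rcons_le1 //.
have fg i : i < N -> f i.+2 = skip1 (g i.+1).
  (* Position N is special: its value, the first letter of [s], passes to the inserted letter N +
     1. *)
  move=> iN; have [e|iN'] := eqVneq i.+1 N.
    rewrite e /f /g; case: (s) l0 => //= y t _; rewrite /next /= !eqxx.
    by rewrite !ifF //; lia.
  (* [h] also skips N + 1, so it carries [N :: s] to the new cycle word without 1 and N + 1. *)
  pose h v := skip1 v + (N <= v).
  have hinj : injective h by move=> a b; rewrite /h /skip1; lia.
  have hE v : v < N -> h v = skip1 v by rewrite /h /skip1; lia.
  have -> : i.+2 = h i.+1 by rewrite hE /skip1; lia.
  have -> : skip1 (g i.+1) = h (g i.+1).
    rewrite hE // ltn_neqAle next_le // andbT.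
    by rewrite -[X in _ != X]g0 (inj_eq (next_inj u)).
  rewrite /g -(next_map hinj u).
  have -> : map h (N :: s) = N.+2 :: map skip1 s.
    rewrite /= {1}/h /skip1; congr cons; first lia.
    by apply/eq_in_map => v /(allP sN) vN; rewrite hE.
  rewrite hE ?/skip1; last lia.
  rewrite /f /next /= (_ : (_ == N.+2) = false); last by apply/negP; lia.
  rewrite ifF; first by apply: next_at_notin; lia.
  by apply/negP; lia.
have -> : [seq f i | i <- iota 2 N] = map skip1 [seq g i.+1 | i <- iota 0 N].
  rewrite (iotaDl 2 0) -!map_comp; apply/eq_in_map => i; rewrite mem_iota => iN.
  exact: fg.
have tN : all (gtn N) [seq g i.+1 | i <- iota 0 N].
  apply/allP => _ /mapP[i + ->]; rewrite mem_iota => iN.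
  by rewrite /= ltn_neqAle next_le // andbT -[X in _ != X]g0 (inj_eq (next_inj u)).
rewrite !av213_cons_max ?(av213_map (in2W skip1_mono)) //.
- by apply: sub_all tN => v /ltnW.
- rewrite all_map; apply: sub_all tN => v /=; rewrite /skip1; lia.
- rewrite /= leqnSn all_map; apply: sub_all tN => v /=; rewrite /skip1; lia.
Qed.

(** * The possible shapes of a valid word *)

Lemma next_headE (T : eqType) (x : T) p : next (x :: p) x = head x p.
Proof. by case: p => [|y p]; rewrite /next /= eqxx. Qed.

Lemma valid_uniq N s : valid N s -> uniq (N :: s).
Proof. by case/and5P=> _ us sN _ _; apply: lt_uniq. Qed.

Lemma valid_lt N s x : valid N s -> x \in s -> x < N.
Proof. by case/and5P=> _ _ /allP sN _ _ /sN. Qed.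

Lemma valid_word N s a b c :
  valid N s -> subseq [:: a; b; c] s -> not213 a b c.
Proof. by case/and5P=> _ _ _ _ /andP[/av213P av _]; apply: av. Qed.

Lemma valid_fixed N s x a b : valid N s -> x < N -> x \notin s ->
  subseq [:: a; b] s -> not213 x a b.
Proof.
case/and5P=> _ _ _ _ /andP[_ /allP fx] xN xs sub.
have:= fx x; rewrite mem_iota (negPf xs) => /(_ xN).
by move/(subseq_pairwise sub); rewrite pairwise2.
Qed.

Lemma valid_line N s i j k : valid N s -> i < j -> j < k -> k <= N ->
  not213 (next (N :: s) i) (next (N :: s) j) (next (N :: s) k).
Proof.
case/and5P=> _ _ _ /av213P av _ ij jk kN; set f := next _; apply: av.
rewrite -[X in subseq X _]/(map f [:: i; j; k]); apply: map_subseq.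
have -> : [:: i; j; k] = [seq x <- iota 0 N.+1 | x \in [:: i; j; k]].
  apply: (irr_sorted_eq ltn_trans ltnn).
  - by rewrite /= ij jk.
  - exact: (sorted_filter ltn_trans _ (iota_ltn_sorted 0 N.+1)).
  - move=> x; rewrite mem_filter mem_iota andb_idr // !inE.
    by case/or3P=> /eqP->; lia.
exact: filter_subseq.
Qed.

Lemma subseq3 (T : eqType) (a b c : T) p q r :
  a \in p -> b \in q -> c \in r -> subseq [:: a; b; c] (p ++ q ++ r).
Proof.
move=> ap bq cr; rewrite -[[:: a; b; c]]/([:: a] ++ [:: b] ++ [:: c]).
by rewrite !cat_subseq ?sub1seq.
Qed.

Lemma uniq_mid_neq (T : eqType) (x y : T) p q :
  uniq (p ++ x :: y :: q) -> x != y.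
Proof.
by rewrite cat_uniq => /and3P[_ _ /andP[]]; rewrite inE negb_or => /andP[].
Qed.

Lemma uniq_cat_neq (T : eqType) (x y : T) p q :
  uniq (p ++ q) -> x \in p -> y \in q -> x != y.
Proof.
rewrite cat_uniq => /and3P[_ /hasPn pq _] xp /pq yp.
by apply: contraNneq yp => <-.
Qed.

(** Suppose [s] starts with b and has k 0 a inside. Positions 0, k, N carry a, 0, b, a pattern if a
    < b; if b < a, then b 0 a is a pattern in [s]. *)
Lemma valid_0_ends N s :
  valid N s -> 0 \in s -> (last 1 s == 0) || (head 1 s == 0).
Proof.
move=> vs s0; case/splitPr: s0 vs => s1 s2 vs.
have u := valid_uniq vs.
case: s2 vs u => [|a s2] vs u; first by rewrite last_cat.
case: s1 vs u => [|b s1] vs u; first by rewrite orbT.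
pose k := last b s1.
have fN := next_headE N ((b :: s1) ++ [:: 0, a & s2]).
have f0 : next (N :: (b :: s1) ++ [:: 0, a & s2]) 0 = a.
  exact: (@next_mid _ (N :: b :: s1)).
have fk : next (N :: (b :: s1) ++ [:: 0, a & s2]) k = 0.
  by move: u; rewrite (lastI b) cat_rcons; apply: (@next_mid _ (N :: belast b s1)).
have a0 : 0 != a by apply: (@uniq_mid_neq _ _ _ (N :: b :: s1)) u.
have k0 : 0 < k by rewrite lt0n; apply: contraNneq a0 => e; rewrite -fk e f0.
have kN : k < N by apply: (valid_lt vs); rewrite mem_cat mem_last.
have := valid_line vs k0 kN (leqnn N); rewrite /= f0 fk fN /=.
have sub : subseq [:: b; 0; a] ((b :: s1) ++ [:: 0] ++ a :: s2).
  by apply: subseq3; rewrite inE eqxx.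
have := valid_word vs sub; rewrite /not213.
have : b != a.
  by apply/eqP => e; move: u; rewrite e /= !mem_cat !inE eqxx !orbT !andbF.
lia.
Qed.

(** Let y be the first letter, k > 1 the letter before the final 0, and f the permutation. Positions
    1, k, N carry f(1), 0, y. If 1 is fixed, this is a pattern. If 1 is followed by c and is not
    first, avoiding c 0 y forces y < c, and y 1 c is a pattern in [s]. *)
Lemma valid_last0 N s : valid N s -> last 1 s = 0 ->
  [\/ s = [:: 0],
     exists t, s = rcons (rcons t 1) 0
   | exists2 z, s = 1 :: rcons z 0 & z != [::]].
Proof.
case/lastP: s => // s x vs; rewrite last_rcons => x0; rewrite {x}x0 in vs *.
have u := valid_uniq vs.
case/lastP: s vs u => [|s k] vs u; first by constructor 1.
have [k1|k1] := eqVneq k 1; first by constructor 2; exists s; rewrite ?k1.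
constructor 3.
have lt x : x \in rcons s k -> 0 < x < N.
  move=> xs; rewrite (valid_lt vs) ?mem_rcons ?inE ?xs ?orbT // andbT lt0n.
  apply/eqP => x0; move: u; rewrite /= [uniq (rcons _ 0)]rcons_uniq.
  by rewrite -{2}x0 xs /= andbF.
have fk : next (N :: rcons (rcons s k) 0) k = 0.
  by move: u; rewrite -cats1 cat_rcons; apply: (@next_mid _ (N :: s)).
have kN : 0 < k < N by apply: lt; rewrite mem_rcons inE eqxx.
have [y [t [yE ylt]]] : exists y t, rcons s k = y :: t /\ 0 < y < N.
  case: (s) lt => [|y t] lt; first by exists k, [::].
  by exists y, (rcons t k); rewrite lt // inE eqxx.
have fN : next (N :: rcons (rcons s k) 0) N = y by rewrite next_headE yE.
have kl1 : 1 < k by lia.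
have [n1|n1] := boolP (1 \in rcons s k); last first.
  have f1 : next (N :: rcons (rcons s k) 0) 1 = 1.
    apply: next_notin; rewrite inE mem_rcons inE /= (negPf n1) orbF; lia.
  have := valid_line vs kl1 _ (leqnn N); rewrite fk fN f1 /not213.
  have : y != 1 by apply: contraNneq n1 => <-; rewrite yE inE eqxx.
  lia.
have n1s : 1 \in s by move: n1; rewrite mem_rcons inE => /predU1P[e|//]; lia.
case/splitPr: n1s vs u lt fk yE fN {n1} => p q vs u lt fk yE fN.
have [c [q' qE]] : exists c q', rcons q k = c :: q'.
  by case: (q) => [|c q']; [exists k, [::] | exists c, (rcons q' k)].
case: p vs u lt fk yE fN => [|y' p] vs u lt fk yE fN.
  by exists (rcons q k) => //; case: (q).
have sE : rcons (rcons ((y' :: p) ++ 1 :: q) k) 0 = (y' :: p) ++ 1 :: rcons (c :: q') 0.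
  by rewrite -qE -!cats1 -!catA.
have y'E : y' = y by case: yE.
have f1 : next (N :: rcons (rcons ((y' :: p) ++ 1 :: q) k) 0) 1 = c.
  rewrite sE; apply: (@next_mid _ (N :: y' :: p)); by move: u; rewrite sE.
have := valid_line vs kl1 _ (leqnn N); rewrite fk fN f1 => /(_ _)/=.
have sub : subseq [:: y; 1; c] (rcons (rcons ((y' :: p) ++ 1 :: q) k) 0).
  by rewrite sE y'E; apply: (@subseq3 _ _ _ _ _ [:: 1]); rewrite inE eqxx.
have := valid_word vs sub; rewrite /not213.
have u' : uniq ((y' :: p) ++ 1 :: rcons (c :: q') 0).
  by move: u; rewrite sE => /andP[].
have : y != 1 by apply: (uniq_cat_neq u'); rewrite ?y'E inE eqxx.
have : y != c by apply: (uniq_cat_neq u'); rewrite ?y'E !inE eqxx ?orbT.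
have := lt c; rewrite rcons_cat /= qE !(inE, mem_cat) eqxx !orbT => /(_ isT).
lia.
Qed.

(** Let y > 1 follow the initial 0, let l be the last letter and f the permutation. Positions 0, 1,
    l carry y, f(1), N, a pattern if 1 is fixed. If 1 is followed by c, avoiding y c N forces y < c,
    and y 1 c is a pattern in [s]. *)
Lemma valid_head0 N s : valid N s -> head 1 s = 0 ->
  [\/ s = [:: 0],
     exists t, s = 0 :: 1 :: t
   | exists2 z, s = 0 :: rcons z 1 & z != [::]].
Proof.
case: s => // x s vs /= x0; rewrite {x}x0 in vs *.
have u := valid_uniq vs.
case: s vs u => [|y s] vs u; first by constructor 1.
have [y1|y1] := eqVneq y 1; first by constructor 2; exists s; rewrite ?y1.
constructor 3.
have lt x : x \in y :: s -> 0 < x < N.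
  move=> xs; rewrite (valid_lt vs) ?[x \in 0 :: _]in_cons ?xs ?orbT // andbT lt0n.
  by apply/eqP => x0; move: u; rewrite -x0 2!cons_uniq xs andbF.
have [_ yN] := andP (lt y (mem_head _ _)).
have f0 : next [:: N, 0, y & s] 0 = y by apply: (@next_mid _ [:: N]).
have y0 : 0 < y by case/andP: (lt y (mem_head _ _)).
pose l := last y s.
have lN : 0 < l < N by apply: lt; rewrite mem_last.
have fl : next [:: N, 0, y & s] l = N by apply: next_lastE u.
have [n1|n1] := boolP (1 \in y :: s); last first.
  have f1 : next [:: N, 0, y & s] 1 = 1.
    by apply: next_notin; rewrite !inE -in_cons (negPf n1) /= orbF; lia.
  have l1 : 1 < l.
    have : l != 1 by apply: contraNneq n1 => <-; rewrite mem_last.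
    lia.
  have := valid_line vs (ltn0Sn 0) l1 _; rewrite f0 f1 fl /not213; lia.
have n1s : 1 \in s by move: n1; rewrite inE eq_sym (negPf y1).
case/splitPr: n1s vs u lt @l lN fl f0 {n1} => p q vs u lt l lN fl f0.
case: q vs u lt @l lN fl f0 => [|c q] vs u lt l lN fl f0.
  by exists (y :: p); rewrite ?cats1.
have f1 : next [:: N, 0, y & p ++ [:: 1, c & q]] 1 = c.
  by apply: (@next_mid _ [:: N, 0, y & p]).
have u' : uniq ((y :: p) ++ [:: 1, c & q]) by case/and3P: u.
have u'' : uniq ((y :: p ++ [:: 1]) ++ c :: q) by rewrite /= -catA.
have l1 : 1 < l.
  have : 1 != l.
    apply: (uniq_cat_neq u''); first by rewrite inE mem_cat mem_head !orbT.
    by rewrite /l last_cat /= mem_last.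
  lia.
have := valid_line vs (ltn0Sn 0) l1 _; rewrite f0 f1 fl => /(_ _)/=.
have sub : subseq [:: y; 1; c] (0 :: y :: p ++ [:: 1, c & q]).
  apply: subseq_trans (subseq_cons _ 0).
  by apply: (@subseq3 _ _ _ _ (y :: p) [:: 1]); rewrite inE eqxx.
have := valid_word vs sub; rewrite /not213.
have : y != c by apply: (uniq_cat_neq u'); rewrite !inE eqxx ?orbT.
lia.
Qed.

(** The first letter c of [z] decides: 2 leads to the increasing word, N + 1 to the insertion of
    [valid_insert], and a value in between to a pattern. *)
Lemma valid_1_0 N z : z != [::] -> valid N.+2 (1 :: rcons z 0) ->
  z = iota 2 N \/
  1 < N /\ exists2 s, 1 :: rcons z 0 = 1 :: N.+1 :: map skip1 s &
             [&& valid N s, last 1 s == 0 & size s == N].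
Proof.
move=> z0 vs; have [c [q zq]] : exists c q, z = c :: q.
  by case: (z) z0 => // c q; exists c, q.
set s := 1 :: rcons z 0 in vs *.
have u := valid_uniq vs; set f := next (N.+2 :: s).
have us : uniq s by case/andP: u.
have f_inj : injective f := next_inj u.
have sz x : x \in z -> x \in s by rewrite /s inE mem_rcons !inE => ->; rewrite !orbT.
have lt x : x \in z -> 1 < x < N.+2.
  move=> xz; rewrite (valid_lt vs (sz _ xz)) andbT ltn_neqAle lt0n.
  move: us; rewrite /s cons_uniq mem_rcons rcons_uniq inE /= => /and3P[n1 n0 _].
  apply/andP; split; first by apply: contraNneq n1 => ->.
  by apply: contraNneq n0 => <-.
have f0 : f 0 = N.+2 by have := next_lastE u; rewrite /= last_rcons.
have f1 : f 1 = c.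
  by move: u; rewrite /f /s zq; apply: (@next_mid _ [:: N.+2]).
have fN : f N.+2 = 1 by rewrite /f next_headE.
have fk : f (last c q) = 0.
  move: u; rewrite /f /s zq (lastI c) -cats1 cat_rcons => u.
  exact: (@next_mid _ (N.+2 :: 1 :: belast c q)).
have ltc : 1 < c < N.+2 by apply: lt; rewrite zq mem_head.
have ltk : 1 < last c q < N.+2 by apply: lt; rewrite zq mem_last.
(* A missing x would precede 1 and N + 1 in the image under theta and form a pattern with them. *)
have full x : N.+1 \in z -> x < N.+2 -> x \in s.
  move=> Nz xN; apply/negPn/negP => xs.
  have sub : subseq [:: 1; N.+1] s.
    by rewrite /s /= sub1seq mem_rcons inE Nz orbT.
  have := valid_fixed vs xN xs sub; rewrite /not213.
  have : x != 0 by apply: contraNneq xs => ->; rewrite /s inE mem_rcons inE eqxx.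
  have : x != 1 by apply: contraNneq xs => ->; rewrite /s inE eqxx.
  have : x != N.+1 by apply: contraNneq xs => ->; apply: sz.
  lia.
have [c2|c2] := eqVneq c 2.
  left.
  (* Otherwise, with k the last letter of [z], positions 1, k, N + 1 carry 2, 0 and a value above
     2. *)
  have kE : last c q = N.+1.
    apply/eqP/negPn/negP => kN.
    have k1 : 1 < last c q by lia.
    have kN1 : last c q < N.+1 by lia.
    have := valid_line vs k1 kN1 (leqnSn _); rewrite -/f fk f1 c2 /not213 /=.
    have : f N.+1 != 0 by rewrite -fk (inj_eq f_inj) eq_sym.
    have : f N.+1 != 2 by rewrite -c2 -f1 (inj_eq f_inj); lia.
    have : f N.+1 != 1 by rewrite -fN (inj_eq f_inj); lia.
    lia.
  have Nz : N.+1 \in z by rewrite -kE zq mem_last.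
  have zE : z = rcons (belast c q) N.+1 by rewrite -kE -lastI.
  apply: (irr_sorted_eq ltn_trans ltnn).
  - have uz : uniq z by move: us; rewrite /s cons_uniq rcons_uniq => /and3P[].
    rewrite (sorted_pairwise ltn_trans) zE pairwise_rcons.
    have ltN : all (ltn^~ N.+1) (belast c q).
      apply/allP => x xz; have := lt x; rewrite zE mem_rcons inE xz orbT => /(_ isT).
      have : x != N.+1.
        by move: uz; rewrite zE rcons_uniq => /andP[Nn _]; apply: contraNneq Nn => <-.
      rewrite /=; lia.
    (* A descent in [z] before its last letter N + 1 would be a pattern. *)
    rewrite ltN; apply: pairwise_subseq => a b sub.
    have sub' : subseq [:: a; b; N.+1] s.
      apply: subseq_trans (subseq_cons _ _); apply: subseq_trans (subseq_rcons _ _).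
      by rewrite zE -cats1 -[[:: a; b; _]]/([:: a; b] ++ _) cat_subseq.
    have := valid_word vs sub'; rewrite /not213.
    have /andP[] : (a < N.+1) && (a != b).
      have aN : a < N.+1 by apply: (allP ltN); rewrite (mem_subseq sub) ?inE ?eqxx.
      rewrite aN /=.
      have : uniq [:: a; b; N.+1] := subseq_uniq sub' us.
      by rewrite /= !inE negb_or => /andP[/andP[]].
    rewrite /=; lia.
  - exact: iota_ltn_sorted.
  - move=> x; rewrite mem_iota; apply/idP/idP => [/lt|xN]; first lia.
    have := full x Nz; rewrite /s inE mem_rcons inE; lia.
right.
have [cN|cN] := eqVneq c N.+1.
  have N1 : 1 < N by lia.
  split=> //.
  have Nz : N.+1 \in z by rewrite zq -cN mem_head.
  have sE : s = 1 :: N.+1 :: rcons q 0 by rewrite /s zq cN.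
  have tlt x : x \in rcons q 0 -> (x == 0) || (1 < x < N.+1).
    move=> xq; have [x0 //|x0] := eqVneq x 0.
    have xs : x \in q by move: xq; rewrite mem_rcons inE (negPf x0).
    have := lt x; rewrite zq inE xs orbT => /(_ isT) /andP[-> xN] /=.
    move: us; rewrite sE 2!cons_uniq => /and3P[_ nN _].
    by rewrite ltn_neqAle -ltnS xN andbT; apply: contraNneq nN => <-.
  have tE : rcons q 0 = map skip1 (map predn (rcons q 0)).
    rewrite -map_comp -[LHS]map_id; apply/eq_in_map => x /tlt /=.
    by rewrite /skip1; lia.
  exists (map predn (rcons q 0)); first by rewrite -tE.
  have l0 : last 1 (map predn (rcons q 0)) = 0 by rewrite map_rcons last_rcons.
  have sz' : size (map predn (rcons q 0)) = N.
    have /perm_size : perm_eq s (iota 0 N.+2).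
      apply: uniq_perm; rewrite ?iota_uniq // => x; rewrite mem_iota.
      by apply/idP/idP => [/(valid_lt vs) //|/(full x Nz)].
    by rewrite sE size_map size_iota /= => -[].
  rewrite -valid_insert ?l0 ?sz' ?eqxx // -?tE -?sE ?vs //.
  by rewrite all_map; apply/allP => x /tlt /=; lia.
exfalso.
(* Now 2 < c < N + 1, and [p] is the position of N + 1. Either p is 2, or avoidance at positions 1,
   2, p applies; both give f(2) > c. So 2 is not fixed, and c, 2, f(2) is a pattern in [s]. *)
have [p [pN fp]] : exists p, p <= N.+2 /\ f p = N.+1.
  have [Ns|Ns] := boolP (N.+1 \in N.+2 :: s).
    exists (prev (N.+2 :: s) N.+1); rewrite /f next_prev //; split=> //.
    by move: Ns; rewrite -mem_prev inE => /predU1P[-> //|/(valid_lt vs)/ltnW].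
  by exists N.+1; rewrite /f next_notin.
have p0 : p != 0 by apply/eqP => p0; move: fp; rewrite p0 f0; lia.
have p1 : p != 1 by apply/eqP => p1; move: fp; rewrite p1 f1; lia.
have f2c : c < f 2.
  have [p2|p2] := eqVneq p 2; first by rewrite -p2 fp; lia.
  have ltp : 2 < p by lia.
  have := valid_line vs (ltnSn 1) ltp pN; rewrite -/f f1 fp /not213.
  have : f 2 != c by rewrite -f1 (inj_eq f_inj).
  lia.
have n2 : 2 \in q.
  apply/negPn/negP => n2; suff f2 : f 2 = 2 by rewrite f2 in f2c; lia.
  apply: next_notin; rewrite inE /s inE mem_rcons inE zq inE (negPf n2) eq_sym; lia.
case/splitPr: n2 zq => q1 q2 zq.
have [d [q3 q2E]] : exists d q3, rcons q2 0 = d :: q3.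
  by case: (q2) => [|d q3]; [exists 0, [::] | exists d, (rcons q3 0)].
have sE : s = (1 :: c :: q1) ++ 2 :: d :: q3.
  by rewrite /s zq -q2E -!cats1 /= -catA.
have f2 : f 2 = d.
  by move: u; rewrite /f sE; apply: (@next_mid _ (N.+2 :: 1 :: c :: q1)).
have sub : subseq [:: c; 2; d] s.
  by rewrite sE; apply: (@subseq3 _ _ _ _ _ [:: 2]); rewrite !inE eqxx ?orbT.
have := valid_word vs sub; rewrite /not213 -f2; lia.
Qed.

(** * Two explicit valid words *)

Lemma av213_iota m n : av213 (iota m n).
Proof.
elim: n m => // n IHn m; rewrite /= av213_cons IHn andbT.
by apply: pairwise_not213_ge; apply/allP => x; rewrite mem_iota => /andP[/ltnW].
Qed.

(** This is the transposition of 0 and N + 1, with one-line word N + 1, 1, ..., N, 0. *)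
Lemma valid_single N : valid N.+1 [:: 0].
Proof.
have nx x : x.+1 < N.+1 -> next [:: N.+1; 0] x.+1 = x.+1.
  by move=> xN; apply: next_notin; rewrite !inE; lia.
rewrite /valid /= (_ : av213 (line _ _) = true) /=; last first.
  rewrite line_rcons next_headE av213_rcons_le1 //=.
  rewrite (_ : next _ 0 = N.+1) // av213_cons_max.
    rewrite (_ : map _ _ = iota 1 N) ?av213_iota //.
    rewrite -[RHS]map_id; apply/eq_in_map => -[|x]; rewrite mem_iota // => xN.
    by apply: nx; lia.
  by apply/allP => _ /mapP[x + ->]; rewrite mem_iota => ?; apply: next_le => //; lia.
by rewrite fixed_okS; apply/allP.
Qed.

(** The one-line word is N + 2, 2, ..., N + 1, 0, 1. *)
Lemma valid_incr N : valid N.+2 (1 :: rcons (iota 2 N) 0).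
Proof.
set s := 1 :: _.
have sE : s = rcons (iota 1 N.+1) 0 by [].
have us : uniq s by rewrite sE rcons_uniq mem_iota iota_uniq.
have sN : all (gtn N.+2) s.
  by apply/allP => x; rewrite sE mem_rcons inE mem_iota /=; lia.
have u := lt_uniq sN us.
rewrite /valid us sN fixed_ok_full //; last by rewrite sE size_rcons size_iota.
rewrite {3}sE av213_rcons_le1 // av213_iota /= andbT.
have f0 : next (N.+2 :: s) 0 = N.+2 by have := next_lastE u; rewrite sE last_rcons.
have fN : next (N.+2 :: s) N.+2 = 1 by rewrite next_headE.
have fN1 : next (N.+2 :: s) N.+1 = 0.
  have sE2 : N.+2 :: s = (N.+2 :: iota 1 N) ++ [:: N.+1; 0].
    by rewrite sE iota_rcons -!cats1 /= -catA.
  by move: u; rewrite sE2; apply: next_mid.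
have fi i : 0 < i <= N -> next (N.+2 :: s) i = i.+1.
  move=> iN; have sE2 :
      N.+2 :: s = (N.+2 :: iota 1 i.-1) ++ i :: i.+1 :: rcons (iota i.+2 (N - i)) 0.
    rewrite sE (_ : N.+1 = i.-1 + (N - i).+2); last by lia.
    by rewrite iotaD rcons_cat /= add1n prednK //; case/andP: iN.
  by move: u; rewrite sE2; apply: next_mid.
rewrite line_rcons fN av213_rcons_le1 //.
rewrite iota_rcons map_rcons fN1 av213_rcons_le1 //.
rewrite /= f0 av213_cons_max; last first.
  by apply/allP => _ /mapP[i + ->]; rewrite mem_iota => ?; apply: next_le => //; lia.
rewrite (_ : map _ _ = iota 2 N) ?av213_iota // (iotaDl 1 1).
by apply/eq_in_map => i; rewrite mem_iota => ?; apply: fi; lia.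
Qed.

(** * Counting cycle words *)

(** Words form an infinite type, so a count is witnessed by a list of all solutions. *)
Definition has_count (T : eqType) (P : pred T) (m : nat) : Prop :=
  exists L : seq T, [/\ uniq L, forall x, (x \in L) = P x & size L = m].

Lemma has_count0 (T : eqType) (P : pred T) : P =1 xpred0 -> has_count P 0.
Proof. by move=> P0; exists [::]; split=> // x; rewrite P0. Qed.

Lemma has_count1 (T : eqType) (P : pred T) x : P =1 pred1 x -> has_count P 1.
Proof. by move=> Px; exists [:: x]; split=> // y; rewrite Px inE. Qed.

Lemma has_count_sum (T1 T2 U : eqType) (P : pred T1) (Q : pred T2) (R : pred U)
    (g : T1 -> U) (h : T2 -> U) m n :
    has_count P m -> has_count Q n -> injective g -> injective h ->
    (forall x, P x -> R (g x)) -> (forall y, Q y -> R (h y)) ->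
    (forall x y, P x -> Q y -> g x != h y) ->
    (forall z, R z -> (exists2 x, P x & z = g x) \/ (exists2 y, Q y & z = h y)) ->
  has_count R (m + n).
Proof.
move=> [L [uL LP <-]] [M [uM MQ <-]] gI hI gR hR gh Rgh.
exists (map g L ++ map h M); split.
- rewrite cat_uniq !map_inj_uniq // uL uM andbT /=.
  apply/hasPn => _ /mapP[y + ->]; rewrite MQ => Qy; apply/mapP => -[x].
  by rewrite LP => Px /eqP; rewrite eq_sym (negPf (gh x y Px Qy)).
- move=> z; rewrite mem_cat; apply/orP/idP => [[]/mapP[x + ->]|/Rgh[][x Px ->]].
  + by rewrite LP => /gR.
  + by rewrite MQ => /hR.
  + by left; rewrite mem_map // LP.
  + by right; rewrite mem_map // MQ.
- by rewrite size_cat !size_map.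
Qed.

Lemma has_count_cons (T : eqType) (P : pred T) x m :
  ~~ P x -> has_count P m -> has_count (predU1 x P) m.+1.
Proof.
move=> Px [L [uL LP <-]]; exists (x :: L); split=> //=; first by rewrite LP Px uL.
by move=> y; rewrite !inE LP.
Qed.

Lemma has_count_rem (T : eqType) (P : pred T) x m :
  P x -> has_count P m.+1 -> has_count [pred y | P y && (y != x)] m.
Proof.
move=> Px [L [uL LP sL]]; exists (rem x L); split; first exact: rem_uniq.
- by move=> y; rewrite mem_rem_uniq // !inE LP andbC.
- by rewrite size_rem ?sL // LP.
Qed.

(** * Families of valid words and their recurrences *)

Definition ends0 N s := valid N s && (last 1 s == 0).
Definition starts0 N s := valid N s && (head 1 s == 0).
(** These words are counted by r(N). *)
Definition full_ends0 N s := ends0 N s && (size s == N).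
(** The words 1 z 0 with [z] nonempty; 1 0 is left out because it arises from the word 0 by raising
    and appending 0. *)
Definition starts1_ends0 N s := [&& ends0 N s, head 0 s == 1 & 2 < size s].

Lemma starts1_ends0P N s :
  reflect (exists z, [/\ z != [::], s = 1 :: rcons z 0 & valid N s])
          (starts1_ends0 N s).
Proof.
apply: (iffP idP) => [/and3P[/andP[vs]]|[z [z0 -> vs]]].
  case: s vs => //= x s vs; case/lastP: s vs => [|s y] vs; first by case: x vs.
  rewrite last_rcons size_rcons => /eqP y0 /eqP x1 ss.
  by rewrite x1 y0 in vs *; exists s; split=> //; case: (s) ss.
by rewrite /starts1_ends0 /ends0 vs /= last_rcons size_rcons; case: z z0 {vs}.
Qed.

Lemma valid_size N s : valid N s -> size s <= N.
Proof.
case/and5P=> _ us /allP sN _ _; rewrite -(size_iota 0 N).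
by apply: uniq_leq_size => // x /sN; rewrite mem_iota.
Qed.

(** Both shapes in [valid_1_0] use every letter below N. *)
Lemma starts1_ends0_full N s : starts1_ends0 N s -> full_ends0 N s.
Proof.
move=> cs; case/and3P: (cs) => l0 _ ss; rewrite /full_ends0 l0 /=.
case/starts1_ends0P: cs ss => z [z0 -> vs] ss; have sN := valid_size vs.
case: N vs sN {l0} => [|[|N]] vs sN; try by lia.
case: (valid_1_0 z0 vs) => [->|[_ [s' -> /and3P[_ _ /eqP <-]]]].
  by rewrite /= size_rcons size_iota.
by rewrite /= size_map.
Qed.

Lemma count_1_0_small N : N <= 2 -> has_count (starts1_ends0 N) 0.
Proof.
move=> N2; apply: has_count0 => s; apply/negP => /and3P[/andP[/valid_size]].
lia.
Qed.

Lemma count_1_0_3 : has_count (starts1_ends0 3) 1.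
Proof.
apply: (@has_count1 _ _ [:: 1; 2; 0]) => s; apply/idP/eqP => [|->].
  case/starts1_ends0P => z [z0 sE vs]; rewrite {}sE in vs *.
  by case: (valid_1_0 z0 vs) => [-> //|[]].
by apply/starts1_ends0P; exists [:: 2]; split=> //; apply: (valid_incr 1).
Qed.

(** The increasing word adds one to the [m] words obtained by insertion. *)
Lemma count_1_0 N m : 1 < N ->
  has_count (full_ends0 N) m -> has_count (starts1_ends0 N.+2) m.+1.
Proof.
move=> N1 cf; rewrite -add1n.
have c1 := has_count1 (frefl (pred1 (1 :: rcons (iota 2 N) 0))).
apply: (@has_count_sum _ _ _ _ _ _ id (fun s => 1 :: N.+1 :: map skip1 s) _ _ c1 cf) => //.
- by move=> s t [] /(inj_map skip1_inj).
- move=> s /eqP ->; apply/starts1_ends0P; exists (iota 2 N); split=> //.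
    by case: (N) N1.
  exact: valid_incr.
- move=> s /andP[/andP[vs /eqP l0] /eqP szs].
  have sN : all (gtn N) s by case/and5P: vs.
  have vs' := vs; rewrite -valid_insert // in vs'.
  rewrite /starts1_ends0 /ends0 vs' /= size_map szs; apply/andP; split; last by lia.
  by case: (s) l0 => //= x t; rewrite last_map => ->.
- move=> s t /eqP -> _; apply/eqP; case: N N1 {cf c1} => // -[|N] // _ /= []; lia.
- move=> s /starts1_ends0P[z [z0 sE vs]]; rewrite sE in vs *.
  case: (valid_1_0 z0 vs) => [zE|[_ [s' s'E /and3P[vs' l0 szs]]]].
    by left; exists (1 :: rcons z 0); rewrite ?zE /=.
  by right; exists s' => //; rewrite /full_ends0 /ends0 vs' l0.
Qed.

Lemma last0_rcons N s : ends0 N s ->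
  ends0 N.+1 (rcons (map S s) 0).
Proof.
by case/andP=> vs /eqP l0; rewrite /ends0 valid_rcons0 // vs last_rcons eqxx.
Qed.

Lemma mapS_pred s : 0 \notin s -> map S (map predn s) = s.
Proof.
move=> s0; rewrite -map_comp -[RHS]map_id; apply/eq_in_map => x xs /=.
by rewrite prednK // lt0n; apply: contraNneq s0 => <-.
Qed.

Lemma rcons_mapS_inj : injective (fun s => rcons (map S s) 0).
Proof. by move=> s t /rcons_inj[] /(inj_map succn_inj). Qed.

Lemma last0P N s : ends0 N.+1 s ->
  [\/ s = [:: 0], exists2 t, ends0 N t & s = rcons (map S t) 0
   | starts1_ends0 N.+1 s].
Proof.
case/andP=> vs /eqP l0; case: (valid_last0 vs l0) => [|[t sE]|[z sE z0]].
- by constructor 1.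
- constructor 2; exists (map predn (rcons t 1)); last first.
    rewrite mapS_pred //.
    have := valid_uniq vs; rewrite sE /= => /andP[_].
    by rewrite rcons_uniq => /andP[].
  have l0' : last 1 (map predn (rcons t 1)) = 0 by rewrite map_rcons last_rcons.
  rewrite /ends0 l0' eqxx andbT -valid_rcons0 // mapS_pred -?sE //.
  have := valid_uniq vs; rewrite sE /= => /andP[_].
  by rewrite rcons_uniq => /andP[].
- by constructor 3; apply/starts1_ends0P; exists z.
Qed.

(** The left side is 0 alone or ends with 1 0; a word 1 z 0 ending so would repeat 1. *)
Lemma rcons_mapS_neq N s t :
  (s == [::]) || (last 1 s == 0) -> starts1_ends0 N t -> rcons (map S s) 0 != t.
Proof.
move=> l0 /starts1_ends0P[z [z0 -> vs]]; apply/eqP; rewrite -rcons_cons => /rcons_inj[sz].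
have := valid_uniq vs; rewrite cons_uniq -rcons_cons rcons_uniq -sz.
case/and3P=> _ _; case: s l0 sz => //= x s /eqP l0 [-> sz].
suff -> : 1 \in map S s by [].
rewrite sz; case: (z) z0 sz => // y z' _.
by case: (s) l0 => //= x' s' l0 [<- <-]; rewrite -[1]/(0.+1) -l0 -last_map mem_last.
Qed.

Lemma count_full_step N m k : 0 < N -> has_count (full_ends0 N) m ->
  has_count (starts1_ends0 N.+1) k -> has_count (full_ends0 N.+1) (m + k).
Proof.
move=> N0 cf c1.
apply: (has_count_sum cf c1 rcons_mapS_inj (@inj_id _)).
- move=> s /andP[ls /eqP szs]; rewrite /full_ends0 last0_rcons //=.
  by rewrite size_rcons size_map szs.
- by move=> s; apply: starts1_ends0_full.
- by move=> s t /andP[/andP[_ l0] _]; apply: rcons_mapS_neq; rewrite l0 orbT.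
- move=> s /andP[/last0P[sE|[t lt sE]|c] szs].
  + by rewrite sE in szs; case: (N) N0 szs.
  + left; exists t => //; rewrite /full_ends0 lt; move: szs.
    by rewrite sE size_rcons size_map.
  + by right; exists s.
Qed.

Lemma count_last0_step N m k : has_count (ends0 N) m ->
  has_count (starts1_ends0 N.+1) k -> has_count (ends0 N.+1) (m.+1 + k).
Proof.
(* The empty word joins the shorter words so that its image accounts for the word 0. *)
move=> cl c1; have {}cl := has_count_cons (isT : ~~ ends0 N [::]) cl.
apply: (has_count_sum cl c1 rcons_mapS_inj (@inj_id _)).
- by move=> s /predU1P[->|/last0_rcons //]; rewrite /ends0 valid_single.
- by move=> s /and3P[].
- move=> s t /predU1P sl; apply: rcons_mapS_neq.
  by case: sl => [->|/andP[_ ->]]; rewrite ?eqxx ?orbT.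
- move=> s /last0P[->|[t lt ->]|c].
  + by left; exists [::].
  + by left; exists t; rewrite //= lt orbT.
  + by right; exists s.
Qed.

Lemma map_swap01_inj : injective (map swap01).
Proof. exact/inj_map/can_inj/swap01K. Qed.

Lemma cons_mapS_inj : injective (fun s => 0 :: map S s).
Proof. by move=> s t [] /(inj_map succn_inj). Qed.

Lemma map_swap01_1_0 z : uniq (1 :: rcons z 0) || uniq (0 :: rcons z 1) ->
  map swap01 (1 :: rcons z 0) = 0 :: rcons z 1.
Proof.
rewrite /= !mem_rcons !rcons_uniq !inE /= map_rcons => u.
congr (_ :: rcons _ _); rewrite -[RHS]map_id; apply/eq_in_map => -[|[|x]] // xz.
- by rewrite xz !andbF in u.
- by rewrite xz !andbF in u.
Qed.

(** Exchanging 0 and 1 turns the words 1 z 0 into the words 0 z 1, so the recurrence is that of the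
    words ending with 0. *)
Lemma count_head0_step N m k : has_count (starts0 N) m ->
  has_count (starts1_ends0 N.+1) k -> has_count (starts0 N.+1) (m.+1 + k).
Proof.
move=> ch c1; have {}ch := has_count_cons (isT : ~~ starts0 N [::]) ch.
apply: (has_count_sum ch c1 cons_mapS_inj map_swap01_inj).
- move=> s /predU1P[->|/andP[vs /eqP h0]]; first by rewrite /starts0 valid_single.
  by rewrite /starts0 valid_cons0 // vs.
- move=> s /starts1_ends0P[z [z0 -> vs]].
  have u : uniq (1 :: rcons z 0) by case/andP: (valid_uniq vs).
  rewrite map_swap01_1_0 ?u //.
  by rewrite /starts0 valid_swap01 // vs.
- move=> s t /predU1P sh /starts1_ends0P[z [z0 -> vs]].
  have u : uniq (1 :: rcons z 0) by case/andP: (valid_uniq vs).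
  rewrite map_swap01_1_0 ?u //.
  apply/eqP => -[]; case: sh => [->|/andP[_ /eqP]]; first by case: (z) z0.
  case: s => //= x s -> {x}; case: z z0 vs u => //= x z _ _ u [x1 _].
  by rewrite x1 inE eqxx in u.
- move=> s /andP[vs /eqP h0]; case: (valid_head0 vs h0) => [->|[t sE]|[z sE z0]].
  + by left; exists [::].
  + left; rewrite sE in vs *; have tE : map S (map predn (1 :: t)) = 1 :: t.
      by apply: mapS_pred; have /and3P[] := valid_uniq vs.
    exists (map predn (1 :: t)); last by rewrite tE.
    by rewrite /= /starts0 -valid_cons0 // tE vs.
  + right; exists (1 :: rcons z 0).
      by apply/starts1_ends0P; exists z; rewrite -valid_swap01 // -sE.
    have u : uniq (0 :: rcons z 1) by rewrite -sE; case/andP: (valid_uniq vs).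
    by rewrite sE map_swap01_1_0 // u orbT.
Qed.

(** A word without 0 is a shorter word raised by one. A word with 0 ends or starts with 0; only the
    word 0 does both, and it is removed from the second family, hence [l.+1]. *)
Lemma count_valid_step N m k l :
    has_count (valid N) m -> has_count (ends0 N.+1) k ->
    has_count (starts0 N.+1) l.+1 -> has_count (valid N.+1) (m + (k + l)).
Proof.
move=> cv cl ch.
have ch0 : starts0 N.+1 [:: 0] by rewrite /starts0 valid_single.
have cu : has_count [pred s | valid N.+1 s && (0 \in s)] (k + l).
  apply: (has_count_sum cl (has_count_rem ch0 ch) (@inj_id _) (@inj_id _)).
  - move=> s /andP[vs /eqP l0]; rewrite /= vs -l0; case: s vs l0 => // x s _ _.
    exact: mem_last.
  - move=> s /andP[/andP[vs /eqP h0] _]; rewrite /= vs -h0; case: s vs h0 => // x s _ _.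
    exact: mem_head.
  - move=> s t /andP[vs /eqP l0] /andP[/andP[_ /eqP h0] t0]; apply: contraNneq t0 => st.
    rewrite -{t}st in h0 *; have /andP[_] := valid_uniq vs.
    case: s vs l0 h0 => // x [|y s] vs l0 /= x0; first by rewrite x0.
    by rewrite x0 -l0 /= mem_last.
  - move=> s /andP[vs s0]; case/orP: (valid_0_ends vs s0) => e0.
      by left; exists s; rewrite // /ends0 vs.
    have [s1|s1] := eqVneq s [:: 0]; last by right; exists s; rewrite //= /starts0 vs e0.
    by left; exists s; rewrite // /ends0 vs s1.
apply: (has_count_sum cv cu (inj_map succn_inj) (@inj_id _)).
- by move=> s vs; rewrite valid_shift.
- by move=> s /andP[].
- by move=> s t _ /andP[_ t0]; apply: contraTneq t0 => <-; rewrite mem0_mapS.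
- move=> s vs; have [s0|s0] := boolP (0 \in s); first by right; exists s; rewrite //= vs.
  by left; exists (map predn s); rewrite ?mapS_pred // -valid_shift mapS_pred.
Qed.

(** * Solving the recurrences *)

Lemma fib_gt0 n : 0 < fib n.+1.
Proof. by elim: n => // n IHn; rewrite [fib _]/= -/(fib n.+1) addn_gt0 IHn. Qed.

Lemma fibSS n : fib n.+2 = fib n.+1 + fib n.
Proof. by []. Qed.

Lemma valid_1 s : valid 1 s -> s = [:: 0].
Proof.
move=> vs; have := valid_size vs; case: s vs => [|x [|y s]] // vs _.
by have := valid_lt vs (mem_head _ _); case: (x).
Qed.

(** With c(N) the number of words 1 z 0, r(N + 1) = r(N) + c(N + 1) and c(N + 2) = r(N) + 1, so r(N)
    + 1 satisfies the Fibonacci recurrence. *)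
Lemma count_full_1_0 N :
  has_count (full_ends0 N.+2) (fib N.+3).-1 /\ has_count (starts1_ends0 N.+3) (fib N.+2).
Proof.
have c11 : has_count (full_ends0 1) 1.
  apply: (@has_count1 _ _ [:: 0]) => s; apply/idP/eqP => [|->].
    by case/andP=> /andP[_]; case: s => [|x [|y s]] //= /eqP ->.
  by rewrite /full_ends0 /ends0 valid_single.
elim/ltn_ind: N => -[_|N IHN].
  split; last exact: count_1_0_3.
  exact: (count_full_step _ c11 (count_1_0_small (leqnn 2))).
have [cf c1] := IHN N (ltnSn _).
have cf' : has_count (full_ends0 N.+3) (fib N.+4).-1.
  suff -> : (fib N.+4).-1 = (fib N.+3).-1 + fib N.+2 by apply: count_full_step.
  by have := fib_gt0 N.+2; rewrite [fib N.+4]fibSS; lia.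
split=> //; have := count_1_0 _ cf; rewrite prednK ?fib_gt0 //; exact.
Qed.

(** The word 0, counted anew at each step, produces the linear term. *)
Lemma count_last0_head0 N : let c := (fib N.+3).-1 + N.+1 in
  has_count (ends0 N.+2) c /\ has_count (starts0 N.+2) c.
Proof.
have base (P : pred (seq nat)) :
    (forall s, P s -> valid 1 s) -> P [:: 0] -> has_count P 1.
  move=> PP P0; apply: (@has_count1 _ _ [:: 0]) => s.
  by apply/idP/eqP => [/PP/valid_1|-> //].
elim: N => [|N [cl ch]] /=.
  have c1 := count_1_0_small (leqnn 2).
  split; [apply: (@count_last0_step 1 1 0 _ c1) | apply: (@count_head0_step 1 1 0 _ c1)];
    apply: base.
  - by move=> s /andP[].
  - by rewrite /ends0 valid_single.
  - by move=> s /andP[].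
  - by rewrite /starts0 valid_single.
have [_ c1] := count_full_1_0 N.
have -> : (fib N.+4).-1 + N.+2 = ((fib N.+3).-1 + N.+1).+1 + fib N.+2.
  by have := fib_gt0 N.+2; rewrite [fib N.+4]fibSS; lia.
by split; [apply: count_last0_step | apply: count_head0_step].
Qed.

(** The formula of the theorem for n = N + 2: [m.+1] includes the identity, and 6n stands on the
    left to avoid truncated subtraction. *)
Lemma count_valid N : exists2 m, has_count (valid N.+1) m &
  m.+1 + 6 * N.+2 = 2 * fib N.+4 + N.+2 ^ 2 + 4.
Proof.
elim: N => [|N [m cv mE]].
  exists 1 => //; apply: (@has_count1 _ _ [:: 0]) => s; apply/idP/eqP => [/valid_1 //|->].
  exact: valid_single.
have [cl ch] := count_last0_head0 N.
exists (m + ((fib N.+3).-1 + N.+1 + ((fib N.+3).-1 + N))).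
  by apply: count_valid_step => //; rewrite -addnS.
by have := fib_gt0 N.+2; move: mE; rewrite (fibSS N.+3) (fibSS N.+2); lia.
Qed.

(** * Permutations and their cycle words *)

Lemma order_iso_213P s :
  reflect (exists a b c, s = [:: a; b; c] /\ b < a < c)
          (order_iso s [:: 2; 1; 3]).
Proof.
apply: (iffP andP) => [[/eqP szs /forallP io]|[a [b [c [-> /andP[ba ac]]]]]].
  case: s szs io => [|a [|b [|c [|d s]]]] //= _ io; exists a, b, c; split=> //.
  have i0 : 0 < 3 by []. have i1 : 1 < 3 by []. have i2 : 2 < 3 by [].
  have /forallP/(_ (Ordinal i0)) /eqP /= -> := io (Ordinal i1).
  by have /forallP/(_ (Ordinal i2)) /eqP /= -> := io (Ordinal i0).
split=> //; apply/forallP => -[[|[|[|i]]] //= _]; apply/forallP => -[[|[|[|j]]] //= _];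
  apply/eqP; lia.
Qed.

Lemma avoids_213 w : avoids w [:: 2; 1; 3] = av213 w.
Proof.
apply/idP/av213P => [/existsPn av a b c /subseqP[m szm mE]|av].
  apply/negP => abc; have /negP[] := av (Tuple (introT eqP szm)).
  by apply/order_iso_213P; exists a, b, c.
apply/existsPn => m; apply/negP => /order_iso_213P[a [b [c [mE abc]]]].
have sub : subseq [:: a; b; c] w by rewrite -mE mask_subseq.
by case/negP: (av a b c sub).
Qed.

(** * The cycle of the largest letter *)

Definition top_cycle (N : nat) (p : 'S_N.+1) : seq nat :=
  [seq val i | i <- cycle_from p ord_max].

Definition one_cycle (N : nat) (p : 'S_N.+1) :=
  forall i, i \notin porbit p ord_max -> p i = i.

Lemma cycle_from_fcycle (N : nat) (p : 'S_N.+1) i : fcycle p (cycle_from p i).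
Proof.
rewrite /cycle_from; have := iter_porbit p i; case: #|_| => //= n e.
have -> : rcons (traject p (p i) n) i = traject p (p i) n.+1.
  by rewrite trajectSr -iterSr /= e.
exact: fpath_traject.
Qed.

Lemma next_cycle_from (N : nat) (p : 'S_N.+1) i j :
  j \in porbit p i -> next (cycle_from p i) j = p j.
Proof.
rewrite -mem_cycle_from => ji; apply: nextE ji; last exact: cycle_from_fcycle.
Qed.

Lemma mem_top_cycle (N : nat) (p : 'S_N.+1) i :
  (val i \in top_cycle p) = (i \in porbit p ord_max).
Proof. by rewrite /top_cycle (mem_map val_inj) mem_cycle_from. Qed.

Lemma next_top_cycle (N : nat) (p : 'S_N.+1) i :
  one_cycle p -> next (top_cycle p) (val i) = val (p i).
Proof.
move=> op; have uc : uniq (cycle_from p ord_max) := uniq_traject_porbit p ord_max.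
rewrite /top_cycle (next_map val_inj uc).
have [ip|ip] := boolP (i \in porbit p ord_max); first by rewrite next_cycle_from.
by rewrite next_notin ?mem_cycle_from // op.
Qed.

Lemma top_cycleE (N : nat) (p : 'S_N.+1) : top_cycle p = N :: behead (top_cycle p).
Proof.
rewrite /top_cycle /cycle_from; have := card_porbit_neq0 p ord_max.
by case: #|_|.
Qed.

Lemma porbit_fixed (N : nat) (p : 'S_N.+1) i : p i = i -> porbit p i = [set i].
Proof.
move=> pi; apply/setP => j; rewrite inE; apply/porbitP/eqP => [[k ->]|->].
  by rewrite permX iter_fix.
by exists 0; rewrite perm1.
Qed.

Lemma cycle_from_fixed (N : nat) (p : 'S_N.+1) i : p i = i -> cycle_from p i = [:: i].
Proof. by move=> pi; rewrite /cycle_from porbit_fixed // cards1. Qed.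

Definition low_maxima (N : nat) (p : 'S_N.+1) : seq 'I_N.+1 :=
  [seq i <- enum 'I_N.+1 | (i != ord_max) && [forall j in porbit p i, j <= i]].

Lemma cycle_maximaE (N : nat) (p : 'S_N.+1) :
  cycle_maxima p = rcons (low_maxima p) ord_max.
Proof.
rewrite /low_maxima /cycle_maxima enum_ordSr !filter_rcons eqxx /=.
have -> : [forall j in porbit p ord_max, j <= N].
  by apply/forallP => j; apply/implyP => _; rewrite -ltnS.
congr rcons; apply: eq_in_filter => _ /mapP[i _ ->].
by rewrite -val_eqE /= neq_ltn ltn_ord.
Qed.

Lemma theta_wordE (N : nat) (p : 'S_N.+1) :
  theta_word p = flatten [seq cycle_from p i | i <- low_maxima p] ++ cycle_from p ord_max.
Proof.
by rewrite /theta_word /standard_cycles cycle_maximaE map_rcons flatten_rcons.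
Qed.

(** Fixed points are one-letter cycles listed increasingly, and the cycle of N comes last. *)
Lemma theta_word_one_cycle (N : nat) (p : 'S_N.+1) : one_cycle p ->
  map val (theta_word p) =
    [seq x <- iota 0 N.+1 | x \notin top_cycle p] ++ top_cycle p.
Proof.
move=> op; rewrite theta_wordE map_cat; congr (_ ++ _).
have lE : low_maxima p = [seq i <- enum 'I_N.+1 | i \notin porbit p ord_max].
  apply: eq_in_filter => i _; have [->|im] := eqVneq i ord_max.
    by rewrite porbit_id.
  have [ip|ip] := boolP (i \in porbit p ord_max) => /=.
    apply/negP => /forallP/(_ ord_max); rewrite porbit_sym ip /= => Ni.
    by case/eqP: im; apply: val_inj => /=; have := ltn_ord i; lia.
  apply/forallP => j; rewrite porbit_fixed ?op // inE; apply/implyP => /eqP -> //.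
have -> : [seq cycle_from p i | i <- low_maxima p] = [seq [:: i] | i <- low_maxima p].
  apply/eq_in_map => i; rewrite lE mem_filter => /andP[ip _].
  by rewrite cycle_from_fixed // op.
rewrite flatten_seq1 lE -val_enum_ord [RHS]filter_map.
apply: (congr1 (map val)).
by apply: eq_filter => i /=; rewrite mem_top_cycle.
Qed.

(** In another nontrivial cycle, the largest letter M is followed in theta p by p M < M and later by
    N. *)
Lemma av213_theta_one_cycle (N : nat) (p : 'S_N.+1) :
  av213 (map val (theta_word p)) -> one_cycle p.
Proof.
move=> av i ip; apply/eqP/negPn/negP => pi.
case: (@arg_maxnP _ i (mem (porbit p i)) val (porbit_id p i)) => M Mi Mmax.
have eP : porbit p M = porbit p i by apply/eqP; rewrite eq_porbit_mem.
have MN : M != ord_max.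
  by apply: contraNneq ip => <-; rewrite eP porbit_id.
have pM : p M != M.
  apply/eqP => pM; have := porbit_id p i; rewrite -eP porbit_fixed // inE => /eqP iM.
  by rewrite iM pM eqxx in pi.
have pMlt : p M < M.
  rewrite ltn_neqAle; apply/andP; split=> //; apply: Mmax.
  by rewrite inE -eP -[X in X \in _]/(aperm M p) -{1}(expg1 p) mem_porbit.
have Mlow : M \in low_maxima p.
  rewrite mem_filter MN mem_enum andbT; apply/forallP => j.
  by apply/implyP; rewrite eP => /Mmax.
have MpM : subseq [:: M; p M] (cycle_from p M).
  rewrite /cycle_from.
  have : 1 < #|porbit p M|.
    rewrite (cardsD1 M) porbit_id ltnS card_gt0; apply/set0Pn; exists (p M).
    by rewrite !inE pM -{1}(expg1 p) mem_porbit.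
  by case: #|_| => [|[|k]] //= _; rewrite !eqxx sub0seq.
have sub : subseq [:: M; p M; ord_max] (theta_word p).
  rewrite theta_wordE; case/splitPr: Mlow => l1 l2.
  rewrite map_cat flatten_cat /= -!catA.
  apply: subseq_trans (suffix_subseq _ _).
  rewrite -[[:: _; _; _]]/([:: M; p M] ++ [:: ord_max]) cat_subseq //.
  apply: subseq_trans (suffix_subseq _ _).
  by rewrite sub1seq mem_cycle_from porbit_id.
have /= := elimT (av213P _) av _ _ _ (map_subseq val sub).
rewrite /not213 pMlt /= -leqNgt => NM.
by case/eqP: MN; apply: val_inj => /=; have := ltn_ord M; lia.
Qed.

(** The letters between x in [F] and the word [s] exceed x, so a pattern starting at x has its other
    letters in [s]. *)
Lemma av213_fixed_cat N F s :
    sorted ltn F -> all (gtn N) F -> all (gtn N) s ->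
  av213 (F ++ N :: s) = all (fun x => pairwise (not213 x) s) F && av213 s.
Proof.
move=> + + sN; elim: F => [|x F IHF] sF FN.
  by rewrite av213_cons_max //; apply: sub_all sN => y /ltnW.
rewrite cat_cons av213_cons IHF ?(path_sorted sF) //; last by case/andP: FN.
rewrite andbA; congr andb; rewrite /= ; congr andb.
have xF : all (ltn x) (rcons F N).
  by rewrite all_rcons (order_path_min ltn_trans sF) andbT; case/andP: FN.
rewrite -cat_rcons pairwise_cat pairwise_not213_ge ?andTb.
  rewrite andb_idl // => _; apply/allrelP => y z /(allP xF) /= + _.
  by rewrite /not213; lia.
by apply: sub_all xF => y /ltnW.
Qed.

Lemma av213_fixed_ok N s : uniq (N :: s) -> all (gtn N) s ->
  av213 ([seq x <- iota 0 N.+1 | x \notin N :: s] ++ N :: s) =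
    av213 s && fixed_ok N s.
Proof.
move=> u sN; rewrite av213_fixed_cat //.
- rewrite andbC /fixed_ok all_filter iota_rcons all_rcons; congr andb.
  rewrite /= add0n inE eqxx /=; apply: eq_in_all => x; rewrite mem_iota => xN.
  rewrite /= inE negb_or.
  have -> /= : x != N by lia.
  by rewrite implybE negbK.
- exact: (sorted_filter ltn_trans _ (iota_ltn_sorted 0 N.+1)).
- apply/allP => x; rewrite mem_filter mem_iota inE negb_or /=; lia.
Qed.

Lemma av213_oneline n (p : 'S_n) :
  av213 (oneline p) = av213 [seq val (p i) | i <- enum 'I_n].
Proof. by rewrite -[RHS]av213_mapS -map_comp. Qed.

Lemma av213_oneline_theta n (p : 'S_n) :
  av213 (oneline (theta p)) = av213 (map val (theta_word p)).
Proof. by rewrite oneline_theta -[RHS]av213_mapS -map_comp. Qed.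

Lemma top_cycle_props N (p : 'S_N.+1) (s := behead (top_cycle p)) :
  uniq (N :: s) /\ all (gtn N) s.
Proof.
have tE := top_cycleE p.
have u : uniq (N :: s).
  by rewrite -tE (map_inj_uniq val_inj) uniq_traject_porbit.
split=> //; apply/allP => x xs.
have : x \in top_cycle p by rewrite tE inE xs orbT.
case/mapP => i _ xE; have := ltn_ord i; rewrite -[nat_of_ord i]xE ltnS leq_eqVlt.
by case/predU1P=> // e; move: u; rewrite /= -{1}e xs.
Qed.

Lemma av213_pair_one_cycle N (p : 'S_N.+1) (s := behead (top_cycle p)) :
    one_cycle p ->
  av213 (oneline p) && av213 (oneline (theta p)) =
    [&& av213 (line N s), av213 s & fixed_ok N s].
Proof.
move=> op; have [u sN] := top_cycle_props p; have tE := top_cycleE p.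
rewrite av213_oneline av213_oneline_theta theta_word_one_cycle // tE.
rewrite av213_fixed_ok //; congr (av213 _ && _).
rewrite /line -val_enum_ord -[RHS]map_comp; apply: eq_map => i /=.
by rewrite -tE next_top_cycle.
Qed.

(** * Good permutations and valid words *)

Definition good N (p : 'S_N.+1) := av213 (oneline p) && av213 (oneline (theta p)).

Lemma good_one_cycle N (p : 'S_N.+1) : good p -> one_cycle p.
Proof.
by case/andP=> _; rewrite av213_oneline_theta => /av213_theta_one_cycle.
Qed.

Lemma good_valid N (p : 'S_N.+1) :
  good p -> p != 1%g -> valid N (behead (top_cycle p)).
Proof.
move=> gp p1; have op := good_one_cycle gp; have [u sN] := top_cycle_props p.
rewrite /valid sN; move: gp; rewrite /good av213_pair_one_cycle // => ->.
have -> : uniq (behead (top_cycle p)) by case/andP: u.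
rewrite !andbT; apply: contraNneq p1 => s0.
apply/eqP/permP => i; rewrite perm1; apply: val_inj.
rewrite -next_top_cycle // top_cycleE s0 /next /=; by case: eqP => // ->.
Qed.

Lemma good1 N : good (1 : 'S_N.+1)%g.
Proof.
have op : one_cycle (1 : 'S_N.+1)%g by move=> i _; rewrite perm1.
have sE : behead (top_cycle (1 : 'S_N.+1)%g) = [::].
  by rewrite /top_cycle cycle_from_fixed ?perm1.
rewrite /good av213_pair_one_cycle // sE; apply/and3P; split=> //.
  rewrite /line (_ : map _ _ = iota 0 N.+1) ?av213_iota // -[RHS]map_id.
  by apply: eq_map => i; rewrite /next /=; case: eqP.
by apply/allP.
Qed.

Lemma valid_good N s : valid N s ->
  exists p : 'S_N.+1, [/\ good p, p != 1%g & behead (top_cycle p) = s].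
Proof.
move=> vs; have u := valid_uniq vs.
have sN : all (gtn N) s by case/and5P: vs.
have nxlt (i : 'I_N.+1) : next (N :: s) i < N.+1.
  by rewrite ltnS next_le // -ltnS.
pose f (i : 'I_N.+1) := Ordinal (nxlt i).
have f_inj : injective f.
  by move=> i j [] /(next_inj u) /val_inj.
pose p := perm f_inj.
have pE i : val (p i) = next (N :: s) (val i) by rewrite permE.
have trE k : map val (traject p ord_max k) = traject (next (N :: s)) N k.
  have trE i : map val (traject p i k) = traject (next (N :: s)) (val i) k.
    by elim: k i => //= k IHk i; rewrite IHk pE.
  exact: trE.
have wE : N :: s = traject (next (N :: s)) N (size s).+1.
  have := cycle_next u; rewrite /= rcons_path => /andP[/fpathE sE _].
  exact: (congr1 (cons N) sE).
(* The letters of [N :: s] form the orbit of N, so [cycle_from] stops after exactly this word. *)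
have card : #|porbit p ord_max| = (size s).+1.
  have ut : uniq (traject p ord_max (size s).+1).
    by rewrite -(map_inj_uniq val_inj) trE -wE.
  rewrite -[RHS](size_traject p ord_max) -(card_uniqP ut); apply: eq_card => j.
  rewrite -(mem_map val_inj) trE -wE.
  apply/porbitP/idP => [[k ->]|js].
    rewrite permX; elim: k => [|k IHk] /=; first by rewrite inE eqxx.
    by rewrite pE mem_next.
  have /trajectP[k _ jE] : j \in traject p ord_max (size s).+1.
    by rewrite -(mem_map val_inj) trE -wE.
  by exists k; rewrite permX.
have tE : top_cycle p = N :: s by rewrite /top_cycle /cycle_from card trE -wE.
have op : one_cycle p.
  move=> i; rewrite -mem_top_cycle tE => iw; apply: val_inj.
  by rewrite pE next_notin.
exists p; split; last by rewrite tE.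
  rewrite /good av213_pair_one_cycle // tE /=.
  by case/and5P: vs => _ _ _ -> ->.
apply/eqP => p1; have := pE ord_max; rewrite p1 perm1 /= next_headE => e.
have s0 : s != [::] by case/and5P: vs.
case: s s0 u e {vs sN nxlt f f_inj p pE trE wE card tE op p1} => //= x s _ + e.
by rewrite -e inE eqxx.
Qed.

(** The identity adds one; every other good permutation is determined by its cycle word. *)
Lemma tcount_valid N m :
  has_count (valid N) m -> tcount N.+1 [:: 2; 1; 3] = m.+1.
Proof.
move=> [L [uL LP <-]].
have -> : tcount N.+1 [:: 2; 1; 3] = #|[set p : 'S_N.+1 | good p]|.
  by apply: eq_card => p; rewrite !inE !avoids_213.
rewrite (cardsD1 1%g) inE good1 add1n; congr _.+1.
rewrite cardE -(size_map (fun p => behead (top_cycle p))).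
apply/perm_size/uniq_perm => //.
  rewrite map_inj_in_uniq ?enum_uniq // => p q.
  rewrite !mem_enum !inE => /andP[_ /good_one_cycle op] /andP[_ /good_one_cycle oq] e.
  apply/permP => i; apply: val_inj.
  by rewrite -!next_top_cycle // (top_cycleE p) (top_cycleE q) e.
move=> s; rewrite LP; apply/mapP/idP => [[p + ->]|/valid_good[p [gp p1 <-]]].
  by rewrite mem_enum !inE => /andP[p1 gp]; apply: good_valid.
by exists p; rewrite // mem_enum !inE p1.
Qed.

(** * The generating function *)

Import GRing.Theory.
Local Open Scope ring_scope.

Lemma gf_denE : gf_den = Poly [:: -1; 4; -5; 1; 2; -1] :> {poly rat}.
Proof.
rewrite /gf_den /= !cons_poly_def !polyCN !polyC1 ?polyC_natr.
ring.
Qed.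

Lemma gf_numE : gf_num = Poly [:: -4; 13; -10; -8; 9; 2] :> {poly rat}.
Proof.
rewrite /gf_num /= !cons_poly_def !polyCN ?polyC_natr.
ring.
Qed.

(** At 0 the closed formula would give 6, but the series starts with 4. *)
Definition gf_coef (m : nat) : rat :=
  if m is 0%N then 4 else 2 * (fib m.+2)%:R + m%:R ^+ 2 - 6 * m%:R + 4.

Local Arguments fib : simpl never.

Lemma gf_coefE m : gf_coef m = quot_coef gf_num gf_den m.
Proof.
apply: quot_coef_unique; first exact: gf_den0.
rewrite gf_denE gf_numE => {}m.
under eq_bigr do rewrite coef_Poly.
rewrite coef_Poly.
case: m => [|[|[|[|[|k]]]]]; rewrite ?big_ord_recl ?big_ord0 //=.
(* The denominator has degree 5, so the remaining terms vanish. *)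
rewrite [X in _ + (_ + (_ + (_ + (_ + (_ + X)))))]big1 ?addr0; last first.
  by move=> i _; rewrite /= nth_nil mul0r.
rewrite /bump /= !subSS !subn0.
(* Degree 5 still meets the exceptional coefficient at 0. From degree 6 on, everything reduces to
   two consecutive Fibonacci numbers. *)
case: k => [|k]; first by [].
rewrite /= nth_nil /gf_coef !fibSS !natrD.
move: (fib k.+1) (fib k) => a b.
ring.
Qed.

Unset Implicit Arguments.

Theorem theorem3p5 (n : nat) (hn : (2 <= n)%N) :
  (tcount n [:: 2%N; 1%N; 3%N])%:Z
    = 2%:Z * (fib (n + 2))%:Z + n%:Z ^+ 2 - 6%:Z * n%:Z + 4%:Z
  /\ (tcount n [:: 2%N; 1%N; 3%N])%:R = quot_coef gf_num gf_den n.
Proof.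
case: n hn => [|[|N]] // _; have [m cv mE] := count_valid N.
rewrite (tcount_valid cv) -gf_coefE addn2; split.
  lia.
have : (m.+1 + 6 * N.+2)%:R = (2 * fib N.+4 + N.+2 ^ 2 + 4)%:R :> rat by rewrite mE.
rewrite /gf_coef expr2 -!natrM => e; apply: (addIr (6 * N.+2)%:R).
rewrite -natrD e !natrD !natrM.
ring.
Qed.
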